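(* Let $d\in\mathbb{N}$. The function $\alpha\mapsto\Delta_d(\alpha)$, defined for $0<\alpha\le\tfrac12$, is upper semicontinuous.
   Context: $B(x,r)$ and $\overline{B}(x,r)$ are open and closed Euclidean balls in $\mathbb{R}^d$. For $0<\alpha\le\frac12$, a Radon measure $\mu$ on $\mathbb{R}^d$ is $\alpha$-porous at $x$ if for all small enough $\varepsilon>0$ the following holds for all small enough $r>0$ (depending on $\varepsilon$): there is $y\in\mathbb{R}^d$ with $B(y,\alpha r)\subset\overline{B}(x,r)$ and $\mu(B(y,\alpha r))\le\varepsilon\mu(\overline{B}(x,r))$. $\mu$ is $\alpha$-porous if it is $\alpha$-porous at $\mu$-almost every $x$. The upper packing dimension of $\mu$ is $\overline{\dim}_{\mathrm p}\mu=\operatorname{ess\,sup}_{x\sim\mu}\limsup_{r\downarrow0}\frac{\log\mu(B(x,r))}{\log r}$, and \[ \Delta_d(\alpha)=\sup\{\overline{\dim}_{\mathrm p}\mu:\ \mu\text{ is an $\alpha$-porous Radon measure on }\mathbb{R}^d\}. \] *)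

(* Defs.v *)
From mathcomp Require Import all_boot all_order all_algebra.
From mathcomp Require Import all_classical all_reals all_analysis.
From mathcomp Require Import ess_sup_inf.

Set Implicit Arguments.
Unset Strict Implicit.
Unset Printing Implicit Defensive.

Import Order.TTheory GRing.Theory Num.Theory.
Import numFieldNormedType.Exports.

Local Open Scope classical_set_scope.
Local Open Scope ring_scope.

(* The norm that the library puts on 'rV[R]_d is the sup norm; it induces the
   usual topology of R^d, but its balls are cubes, so the Euclidean norm and
   its balls are defined here. *)
Definition enorm (R : realType) (d : nat) (x : 'rV[R]_d) : R :=
  Num.sqrt (\sum_(i < d) x ord0 i ^+ 2).

Definition eball (R : realType) (d : nat) (x : 'rV[R]_d) (r : R) :
    set 'rV[R]_d :=
  [set y | enorm (y - x) < r].

Definition ecball (R : realType) (d : nat) (x : 'rV[R]_d) (r : R) :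
    set 'rV[R]_d :=
  [set y | enorm (y - x) <= r].

Definition borelRd (R : realType) (d : nat) :=
  g_sigma_algebraType (@open 'rV[R]_d).

Local Open Scope ereal_scope.

Definition is_radon (R : realType) (d : nat)
    (mu : {measure set (borelRd R d) -> \bar R}) : Prop :=
  [/\ forall K : set 'rV[R]_d, compact K -> mu K < +oo,
      forall A : set (borelRd R d), measurable A ->
        mu A = ereal_inf
          [set mu U | U in [set U : set 'rV[R]_d | open U /\ A `<=` U]]
    & forall U : set 'rV[R]_d, open U ->
        mu U = ereal_sup
          [set mu K | K in [set K : set 'rV[R]_d | compact K /\ K `<=` U]]].

Definition porous_at (R : realType) (d : nat) (alpha : R)
    (mu : {measure set (borelRd R d) -> \bar R}) (x : 'rV[R]_d) : Prop :=
  \forall e \near 0%R^'+, \forall r \near 0%R^'+, exists y : 'rV[R]_d,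
    eball y (alpha * r)%R `<=` ecball x r /\
    mu (eball y (alpha * r)%R) <= e%:E * mu (ecball x r).

Definition porous (R : realType) (d : nat) (alpha : R)
    (mu : {measure set (borelRd R d) -> \bar R}) : Prop :=
  {ae mu, forall x, porous_at alpha mu x}.

(* [lne 0 = -oo], so the quotient is +oo when the ball is null and r < 1. *)
Definition upper_local_dim (R : realType) (d : nat)
    (mu : {measure set (borelRd R d) -> \bar R}) (x : 'rV[R]_d) : \bar R :=
  limf_esup (fun r : R => lne (mu (eball x r)) / (ln r)%:E) 0%R^'+.

(* The zero measure has upper packing dimension -oo. *)
Definition upper_packing_dim (R : realType) (d : nat)
    (mu : {measure set (borelRd R d) -> \bar R}) : \bar R :=
  ess_sup mu (upper_local_dim mu).

Definition Delta (R : realType) (d : nat) (alpha : R) : \bar R :=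
  ereal_sup [set upper_packing_dim mu | mu in
    [set mu : {measure set (borelRd R d) -> \bar R} |
      is_radon mu /\ porous alpha mu]].

(* The mirror image of the library's [lower_semicontinuous], for a function
   restricted to A with its relative topology. *)
Definition upper_semicontinuous_on (R : realType) (T : topologicalType)
    (A : set T) (f : T -> \bar R) : Prop :=
  forall x, A x -> forall a : R, f x < a%:E ->
    \forall y \near within A (nbhs x), f y < a%:E.

(* Main.v *)
Require Import Defs.
From mathcomp Require Import all_boot all_order all_algebra.
From mathcomp Require Import all_classical all_reals all_analysis.
From mathcomp Require Import measurable_realfun ring lra.

(* Suppose [Delta d alpha < a]; we bound the local dimensions of
   [alpha']-porous measures by [a] for [alpha'] close to [alpha].  Encode the points
   of the unit cube by words over the [B^d] digits of their [B]-adic expansion,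
   with [B] large.  For [b] between [Delta d alpha] and [a], consider finite
   trees of words that carry a weight giving mass at most [B^(-b l)] to the words
   of length [l] and whose points have holes of size [alpha], up to an error
   [delta], at all scales between [delta] and 1.
   - If such trees exist for every [delta], their weights have a limit along an
     ultrafilter; the constants being uniform, this limit is a measure with exact
     [alpha]-holes and local dimensions at least [b], which is impossible.
   - Otherwise they fail to exist for some [delta] and some height [M].  Let [mu]
     be [alpha']-porous with [alpha' >= alpha - delta/2].  In each small cube,
     the cells of generation [M] that meet the good points and carry more than a
     fraction [eps] of the mass form a tree with the required holes, since a hole
     of [mu] cannot contain a heavy cell.  By max-flow min-cut this tree has a cut
     [C] with [sum_(q in C) B^(-b |q|) < 1].  Iterating the cuts and using the
     Cauchy-Schwarz inequality, [sum_w sqrt (mu w)] over the cells of generation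
     [n] is at most a constant times [B^(b' n / 2)], where [b < b' < a].  The cells
     with [mu w <= B^(-a n)] thus have summable total mass, and by Borel-Cantelli
     [mu]-almost every point has upper local dimension at most [a]. *)

Set Implicit Arguments.
Unset Strict Implicit.
Unset Printing Implicit Defensive.

Import Order.TTheory GRing.Theory Num.Theory.
Import numFieldNormedType.Exports.

Local Open Scope classical_set_scope.
Local Open Scope ring_scope.

(** * Flows and cuts on a finite tree *)

Section Words.
Context {R : realFieldType} {D : finType}.
Implicit Types (w q : seq D) (phi : seq D -> R).

Lemma sum_words0 phi : \sum_(w : 0.-tuple D) phi w = phi [::].
Proof.
rewrite (bigD1 [tuple]) //= big1 ?addr0 // => w /eqP[].
by rewrite [w]tuple0; apply: val_inj.
Qed.

Lemma sum_wordsS l phi :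
  \sum_(w : l.+1.-tuple D) phi w = \sum_i \sum_(w : l.-tuple D) phi (i :: w).
Proof.
rewrite pair_bigA /=.
rewrite (reindex (fun p : D * l.-tuple D => [tuple of p.1 :: p.2])) //=.
exists (fun w : l.+1.-tuple D => (thead w, [tuple of behead w])).
  by move=> [i w] _ /=; congr pair; apply: val_inj.
by move=> w _; apply: val_inj; rewrite /= [w in RHS]tuple_eta.
Qed.

Lemma sum_words_cat l m phi :
  \sum_(w : (l + m).-tuple D) phi w =
  \sum_(q : l.-tuple D) \sum_(w : m.-tuple D) phi (q ++ w).
Proof.
elim: l phi => [|l IH] phi.
  by rewrite (sum_words0 (fun q => \sum_(w : m.-tuple D) phi (q ++ w))).
rewrite (sum_wordsS _ (fun q => \sum_(w : m.-tuple D) phi (q ++ w))).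
rewrite -[LHS]/(\sum_(w : (l + m).+1.-tuple D) phi w) sum_wordsS.
by apply: eq_bigr => i _; rewrite (IH (fun w => phi (i :: w))).
Qed.

Lemma sum_words_take l n phi (C : pred (seq D)) : (l <= n)%N ->
  \sum_(w : n.-tuple D) (C (take l w))%:R * phi w =
  \sum_(q : l.-tuple D) (C q)%:R * \sum_(w : (n - l).-tuple D) phi (q ++ w).
Proof.
move=> ln; rewrite -[n in LHS](subnKC ln).
rewrite (sum_words_cat _ _ (fun w => (C (take l w))%:R * phi w)).
apply: eq_bigr => q _; rewrite mulr_sumr; apply: eq_bigr => w _.
by rewrite take_size_cat ?size_tuple.
Qed.

(* [W w] is the flow through the node [w], whose capacity is [c (size w)]; it
   ends in the leaves allowed by [P], which [C] cuts off from the root. *)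
Lemma max_flow_min_cut h (c : nat -> R) (P : pred (seq D)) :
  (forall l, 0 <= c l) ->
  exists (W : seq D -> R) (C : pred (seq D)),
  [/\ forall w, 0 <= W w,
      forall w, (size w < h)%N -> W w = \sum_i W (rcons w i),
      forall w, (size w <= h)%N -> W w <= c (size w),
      forall w, size w = h -> 0 < W w -> P w
    & W [::] = \sum_(l < h.+1) \sum_(q : l.-tuple D) (C q)%:R * c l /\
      forall w, size w = h -> P w -> exists2 l, (l <= h)%N & C (take l w)].
Proof.
elim: h c P => [|h IH] c P c0.
  exists (fun=> (P [::])%:R * c 0%N), (fun=> P [::]).
  split=> //; first by move=> w; rewrite mulr_ge0.
  - by case=> //= _; case: (P _); rewrite ?mul1r ?mul0r.
  - by case=> //= _; case: (P _) => //; rewrite mul0r ltxx.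
  - rewrite big_ord1 (sum_words0 (fun=> (P [::])%:R * c 0%N)); split=> //.
    by move=> [|//] _ P0; exists 0%N.
have /choice [WC WCP] : forall i, exists WC : (seq D -> R) * pred (seq D),
  [/\ forall w, 0 <= WC.1 w,
      forall w, (size w < h)%N -> WC.1 w = \sum_j WC.1 (rcons w j),
      forall w, (size w <= h)%N -> WC.1 w <= c (size w).+1,
      forall w, size w = h -> 0 < WC.1 w -> P (i :: w)
    & WC.1 [::] = \sum_(l < h.+1) \sum_(q : l.-tuple D) (WC.2 q)%:R * c l.+1 /\
      forall w, size w = h -> P (i :: w) ->
        exists2 l, (l <= h)%N & WC.2 (take l w)].
  move=> i; have [|W [C WC]] := IH (fun l => c l.+1) (fun w => P (i :: w)).
    by move=> l.
  by exists (W, C).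
pose s := \sum_i (WC i).1 [::].
have s0 : 0 <= s by apply: sumr_ge0 => i _; case: (WCP i).
(* If the flows of the subtrees together fit the capacity of the root, they are kept and their cuts
   are joined. Otherwise they are scaled down to fill the root, and the root alone is the cut. *)
have [sc|cs] := leP s (c 0%N).
  exists (fun w => if w is i :: w' then (WC i).1 w' else s).
  pose C w := if w is i :: w' then (WC i).2 w' else false.
  exists C; split.
  - by case=> // i w; case: (WCP i).
  - by case=> // i w /= wh; case: (WCP i) => _ + _ _ _ => ->.
  - by case=> // i w /= wh; case: (WCP i) => _ _ + _ _; apply.
  - by case=> // i w /= [wh] W0; case: (WCP i) => _ _ _ + _; apply.
  - split.
      rewrite big_ord_recl.
      have /= -> := sum_words0 (fun q => (C q)%:R * c 0%N).
      rewrite mul0r add0r.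
      under [RHS]eq_bigr => l _.
        have /= -> := sum_wordsS l (fun q => (C q)%:R * c l.+1).
        over.
      rewrite exchange_big /=; apply: eq_bigr => i _.
      by case: (WCP i) => _ _ _ _ [-> _].
    case=> // i w /= [wh] Pw; case: (WCP i) => _ _ _ _ [_ /(_ w wh Pw)[l lh Cl]].
    by exists l.+1.
have s_gt0 : 0 < s by apply: le_lt_trans cs.
have cs01 : 0 <= c 0%N / s by rewrite divr_ge0.
have cs1 : c 0%N / s <= 1 by rewrite ler_pdivrMr // mul1r ltW.
exists (fun w => if w is i :: w' then c 0%N / s * (WC i).1 w' else c 0%N).
exists (pred1 [::]).
split.
- by case=> // i w; rewrite mulr_ge0 //; case: (WCP i).
- case=> [|i w] /= wh; first by rewrite -mulr_sumr mulfVK ?gt_eqF.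
  by rewrite -mulr_sumr; case: (WCP i) => _ /(_ w wh) -> _ _ _.
- case=> // i w /= wh; case: (WCP i) => W0 _ /(_ w wh) + _ _.
  by apply: le_trans; rewrite ler_piMl.
- case=> // i w /= [wh] W0; case: (WCP i) => W0' _ _ /(_ w wh) + _; apply.
  rewrite lt_neqAle W0' andbT; apply: contraTneq W0 => <-.
  by rewrite mulr0 ltxx.
- split.
    rewrite big_ord_recl.
    have /= -> := sum_words0 (fun q => (q == [::])%:R * c 0%N).
    rewrite mul1r big1 ?addr0 // => l _; apply: big1 => q _.
    by rewrite -size_eq0 size_tuple /= mul0r.
  by move=> w _ _; exists 0%N; rewrite ?take0.
Qed.

(** Each word that contributes has a prefix in the cut, and grouping words by such prefixes can only
    count them too often. The cut may depend on the generation, so that cells can be added to it in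
    the last generation only. *)
Lemma sum_words_le_cut n M phi (C : nat -> pred (seq D)) : (M <= n)%N ->
  (forall w, 0 <= phi w) ->
  (forall w, size w = n -> 0 < phi w -> exists2 l, (l <= M)%N & C l (take l w)) ->
  \sum_(w : n.-tuple D) phi w <=
  \sum_(l < M.+1) \sum_(q : l.-tuple D)
     (C l q)%:R * \sum_(w : (n - l).-tuple D) phi (q ++ w).
Proof.
move=> Mn phi0 H.
under [leRHS]eq_bigr => l _.
  rewrite -(sum_words_take phi (C l)); last first.
    by rewrite (leq_trans _ Mn) // -ltnS.
  over.
rewrite exchange_big /=; apply: ler_sum => w _.
have [/eqP ->|pw] := boolP (phi w == 0); first by rewrite big1 // => i _; rewrite mulr0.
have {pw} pw : 0 < phi w by rewrite lt_neqAle eq_sym pw phi0.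
have [l lM Cl] := H _ (size_tuple w) pw.
rewrite (bigD1 (Ordinal (lM : (l < M.+1)%N))) //= Cl mul1r lerDl.
by apply: sumr_ge0 => i _; rewrite mulr_ge0.
Qed.

End Words.

(* Cauchy-Schwarz, where [t ^- 2] bounds the cardinal of [C]. *)
Lemma sum_sqrt_le {R : rcfType} (I : finType) (C : pred I) (m : I -> R)
    (t G : R) : 0 < t -> 0 <= G -> (forall i, 0 <= m i) ->
  \sum_i m i <= G ^+ 2 -> \sum_i (C i)%:R * t ^+ 2 <= 1 ->
  \sum_i (C i)%:R * Num.sqrt (m i) <= G / t.
Proof.
move=> t0 G0 m0 mG Ct.
have [G_eq0|G_gt0] := leP G 0.
  have mi0 i : m i = 0.
    apply/eqP; rewrite eq_le m0 andbT; apply: (@le_trans _ _ (\sum_j m j)).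
      by rewrite (bigD1 i) //= lerDl sumr_ge0.
    by apply: (le_trans mG); rewrite (le_anti (introT andP (conj G_eq0 G0))) expr0n.
  rewrite big1 ?divr_ge0 ?(ltW t0) // => i _.
  by rewrite mi0 sqrtr0 mulr0.
(* Arithmetic-geometric mean inequality, weighted so that each of the two sums contributes at most
   [G / t / 2]. *)
have H i : (C i)%:R * Num.sqrt (m i) <=
           (m i) * (G^-1 * t^-1 / 2) + (C i)%:R * t ^+ 2 * (G / t / 2).
  have := sqr_sqrtr (m0 i); have := sqrtr_ge0 (m i).
  set x := Num.sqrt _ => x0 <-.
  have tn : t != 0 by rewrite gt_eqF.
  have Gn : G != 0 by rewrite gt_eqF.
  case: (C i); last first.
    rewrite !mul0r addr0 !mulr_ge0 ?invr_ge0 ?exprn_ge0 ?(ltW t0) //.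
  rewrite !mul1r -subr_ge0.
  have -> : x ^+ 2 * (G^-1 * t^-1 / 2) + t ^+ 2 * (G / t / 2) - x =
     (x - G * t) ^+ 2 * (G^-1 * t^-1 / 2) by field; rewrite tn Gn.
  by rewrite mulr_ge0 ?sqr_ge0 // !mulr_ge0 ?invr_ge0 ?(ltW t0).
apply: le_trans (ler_sum _ (fun i _ => H i)) _.
rewrite big_split /= -mulr_suml -mulr_suml.
rewrite [leRHS](_ : _ = G ^+ 2 * (G^-1 * t^-1 / 2) + 1 * (G / t / 2)); last first.
  by field; rewrite !gt_eqF.
apply: lerD; rewrite ler_wpM2r //.
  by rewrite !mulr_ge0 ?invr_ge0 ?(ltW t0).
by rewrite !mulr_ge0 ?invr_ge0 ?(ltW t0).
Qed.

(** * The Euclidean norm *)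

Section EuclideanNorm.
Context {R : realType} {d : nat}.
Implicit Types (x y z : 'rV[R]_d) (r : R).

Lemma enorm_ge0 x : 0 <= enorm x.
Proof. exact: sqrtr_ge0. Qed.

Lemma sqr_enorm x : enorm x ^+ 2 = \sum_(i < d) x ord0 i ^+ 2.
Proof. by rewrite sqr_sqrtr // sumr_ge0 // => i _; exact: sqr_ge0. Qed.

Lemma enormZ (c : R) x : enorm (c *: x) = `|c| * enorm x.
Proof.
rewrite /enorm -sqrtr_sqr -sqrtrM ?sqr_ge0 // mulr_sumr; congr Num.sqrt.
by apply: eq_bigr => i _; rewrite mxE exprMn.
Qed.

Lemma enormN x : enorm (- x) = enorm x.
Proof. by rewrite -scaleN1r enormZ normrN1 mul1r. Qed.

Lemma enormB x y : enorm (x - y) = enorm (y - x).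
Proof. by rewrite -opprB enormN. Qed.

Lemma enorm0 : enorm (0 : 'rV[R]_d) = 0.
Proof. by rewrite -(scale0r 0) enormZ normr0 mul0r. Qed.

Lemma coord_le_enorm x i : `|x ord0 i| <= enorm x.
Proof.
rewrite -sqrtr_sqr ler_sqrt; last by rewrite sumr_ge0 // => j _; exact: sqr_ge0.
by rewrite (bigD1 i) //= lerDl sumr_ge0 // => j _; exact: sqr_ge0.
Qed.

Lemma enorm_eq0 x : enorm x = 0 -> x = 0.
Proof.
move=> x0; apply/rowP => i; rewrite mxE; apply/eqP.
by rewrite -normr_le0 -x0 coord_le_enorm.
Qed.

Lemma enormD x y : enorm (x + y) <= enorm x + enorm y.
Proof.
have [x0|xn0] := eqVneq (enorm x) 0; first by rewrite (enorm_eq0 x0) enorm0 !add0r.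
have [y0|yn0] := eqVneq (enorm y) 0; first by rewrite (enorm_eq0 y0) enorm0 !addr0.
have a0 : 0 < enorm x by rewrite lt_neqAle eq_sym xn0 enorm_ge0.
have b0 : 0 < enorm y by rewrite lt_neqAle eq_sym yn0 enorm_ge0.
rewrite -(@ler_pXn2r _ 2) ?nnegrE ?addr_ge0 ?enorm_ge0 // sqr_enorm.
(* The weights are such that the right-hand sides add up to exactly [(enorm x + enorm y) ^+ 2]. *)
have H i : (x + y) ord0 i ^+ 2 <= (1 + enorm y / enorm x) * x ord0 i ^+ 2
   + (1 + enorm x / enorm y) * y ord0 i ^+ 2.
  rewrite mxE -subr_ge0.
  have -> : forall a b u v : R, a != 0 -> b != 0 ->
    (1 + b / a) * u ^+ 2 + (1 + a / b) * v ^+ 2 - (u + v) ^+ 2 =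
    (b * u - a * v) ^+ 2 / (a * b).
    by move=> a b u v a_n b_n; field; rewrite a_n b_n.
  - by rewrite divr_ge0 ?sqr_ge0 ?mulr_ge0 ?enorm_ge0.
  - exact: xn0.
  - exact: yn0.
apply: le_trans (ler_sum _ (fun i _ => H i)) _.
rewrite big_split /= -!mulr_sumr -!sqr_enorm.
by rewrite le_eqVlt; apply/orP; left; apply/eqP; field; rewrite ?xn0 ?yn0.
Qed.

Lemma enorm_triangle y x z : enorm (x - z) <= enorm (x - y) + enorm (y - z).
Proof. by rewrite -[x - z](subrKA y) enormD. Qed.

Lemma enorm_le_coord x r : 0 <= r -> (forall i, `|x ord0 i| <= r) ->
  enorm x <= d%:R * r.
Proof.
move=> r0 H; rewrite -(@ler_pXn2r _ 2) ?nnegrE ?mulr_ge0 ?enorm_ge0 //.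
rewrite sqr_enorm; apply: (@le_trans _ _ (\sum_(i < d) r ^+ 2)).
  apply: ler_sum => i _; rewrite -real_normK ?num_real //.
  by rewrite ler_pXn2r ?nnegrE.
rewrite sumr_const card_ord exprMn -[leLHS]mulr_natl -natrX.
by rewrite ler_wpM2r ?sqr_ge0 // ler_nat; case: (d) => // k; rewrite leq_pmulr.
Qed.

Lemma norm_le_enorm x : `|x| <= enorm x.
Proof.
rewrite [leLHS]/Num.norm /= mx_normrE; apply/bigmax_leP; split.
  exact: enorm_ge0.
by move=> [i j] _ /=; rewrite ord1 coord_le_enorm.
Qed.

Lemma coord_le_norm x i : `|x ord0 i| <= `|x|.
Proof.
rewrite [leRHS]/Num.norm /= mx_normrE; apply/bigmax_geP; right => /=.
by exists (ord0, i).
Qed.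

Lemma enorm_le_norm x : enorm x <= d%:R * `|x|.
Proof. by apply: enorm_le_coord => // i; exact: coord_le_norm. Qed.

Lemma rV_ballE x r y : 0 < r -> ball x r y <-> forall i, `|x ord0 i - y ord0 i| < r.
Proof.
move=> r0; split=> [[_ H] i|H]; first exact: H.
by split=> // i j; rewrite ord1; exact: H.
Qed.

Lemma continuous_enorm y : continuous (fun x => enorm (x - y)).
Proof.
move=> x; apply/(@cvgrPdist_lt _ _ _ (nbhs x)) => e e0.
have de0 : 0 < e / d.+1%:R by rewrite divr_gt0.
apply/nbhs_ballP; exists (e / d.+1%:R) => //= z; rewrite -ball_normE /= => xz.
have K u v : enorm (u - y) - enorm (v - y) <= d.+1%:R * `|u - v|.
  rewrite lerBlDr; apply: (le_trans (enorm_triangle v u y)).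
  rewrite lerD2r; apply: (le_trans (enorm_le_norm _)).
  by rewrite ler_wpM2r // ler_nat.
have H u v : `|u - v| < e / d.+1%:R -> enorm (u - y) - enorm (v - y) < e.
  by rewrite ltr_pdivlMr // mulrC; apply: le_lt_trans.
by rewrite ltr_norml ltrNl opprB !H // distrC.
Qed.

Lemma closed_norm_le (C : R) : closed [set x : 'rV[R]_d | `|x| <= C].
Proof.
rewrite -[X in closed X]/((fun x : 'rV[R]_d => `|x|) @^-1` [set t | t <= C]).
by apply: closed_comp => [x _|]; [exact: norm_continuous | exact: closed_le].
Qed.

Lemma compact_norm_le (C : R) : compact [set x : 'rV[R]_d | `|x| <= C].
Proof.
apply: bounded_closed_compact; last exact: closed_norm_le.
exists C; split; first exact: num_real.
by move=> M CM x xC; exact: le_trans xC (ltW CM).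
Qed.

Lemma eball_open y r : open (eball y r).
Proof.
have -> : eball y r = (fun x => enorm (x - y)) @^-1` [set t | t < r] by [].
by apply: open_comp => [x _|]; [exact: continuous_enorm | exact: open_lt].
Qed.

(* Extends the segment from [x] to [y] beyond [y] up to the boundary of the
   smaller ball. *)
Lemma eball_sub_ecball (y x : 'rV[R]_d) (a r : R) : 0 < a <= r ->
  eball y a `<=` ecball x r -> enorm (y - x) <= r - a.
Proof.
move=> /andP[a0 ar] H.
have [e0|en0] := eqVneq (enorm (y - x)) 0; first by rewrite e0 subr_ge0.
have e_gt0 : 0 < enorm (y - x) by rewrite lt_neqAle eq_sym en0 enorm_ge0.
rewrite lerBrDr; apply/ler_addgt0Pr => e e_pos.
(* The small ball is open, so the extended point stays at a distance [t < a] from [y], with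
   [t >= a - e]. *)
have t0 : 0 <= Num.max 0 (a - e) by rewrite le_max lexx.
set t := Num.max 0 (a - e) in t0.
have ta : t < a by rewrite /t gt_max a0 ltrBlDr ltrDl.
have /H : eball y a (y + (t / enorm (y - x)) *: (y - x)).
  rewrite /eball /= addrC addKr enormZ ger0_norm ?divr_ge0 ?enorm_ge0 //.
  by rewrite divfK.
rewrite /ecball /= addrAC -{1}[y - x]scale1r -scalerDl enormZ.
rewrite ger0_norm ?addr_ge0 ?divr_ge0 ?enorm_ge0 // mulrDl mul1r divfK // => H'.
have : a - e <= t by rewrite /t le_max lexx orbT.
by rewrite lerBlDr => /(lerD (lexx (enorm (y - x))))/le_trans; apply; rewrite addrA lerD2r.
Qed.

Lemma eball_subset (y x : 'rV[R]_d) (a r : R) :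
  enorm (y - x) <= r - a -> eball y a `<=` ecball x r.
Proof.
move=> H z; rewrite /eball /ecball /= => za.
apply: (le_trans (enorm_triangle y z x)).
by rewrite -(subrKC a r) lerD // ltW.
Qed.

End EuclideanNorm.

(** * Finite Borel measures on R^d are Radon *)

Section FiniteBorelRadon.
Context {R : realType} {d : nat}.
Local Open Scope ereal_scope.
Implicit Types (U F A : set 'rV[R]_d).

Lemma open_measurable_borelRd U : open U -> measurable (U : set (borelRd R d)).
Proof. exact: sub_sigma_algebra. Qed.

Lemma closed_measurable_borelRd F :
  closed F -> measurable (F : set (borelRd R d)).
Proof.
move=> cF; rewrite -(setCK F); apply: measurableC; apply: open_measurable_borelRd.
exact: closed_openC.
Qed.

(** The usual compact exhaustion of an open set: sup-norm distance at least [1/(n+1)] to the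
    complement, norm at most [n]. *)
Definition compact_core U (n : nat) : set 'rV[R]_d :=
  [set x | (forall y, ~ U y -> ~ ball y n.+1%:R^-1 x) /\ (`|x| <= n%:R)%R].

Lemma compact_core_sub U n : compact_core U n `<=` U.
Proof.
move=> x [H _]; apply: contrapT => Ux; apply: (H _ Ux).
by apply: ballxx; rewrite invr_gt0.
Qed.

Lemma compact_core_closed U n : closed (compact_core U n).
Proof.
have -> : compact_core U n =
  ~` (\bigcup_(y in ~` U) ball y n.+1%:R^-1) `&`
  [set x : 'rV[R]_d | (`|x| <= n%:R)%R].
  apply/seteqP; split=> x [H Hn]; split=> //.
    by move=> [y Uy yx]; exact: (H y).
  by move=> y Uy yx; apply: H; exists y.
apply: closedI.
  apply: open_closedC; apply: bigcup_open => y _.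
  by apply: ball_open; rewrite invr_gt0.
exact: closed_norm_le.
Qed.

Lemma compact_core_compact U n : compact (compact_core U n).
Proof.
apply: subclosed_compact (@compact_norm_le R d n%:R) _; last by move=> x [].
exact: compact_core_closed.
Qed.

Lemma compact_core_nondecreasing U : nondecreasing_seq (compact_core U).
Proof.
move=> m n mn; apply/subsetPset => x [H xm]; split.
  move=> y Uy yx; apply: (H y Uy); apply: le_ball yx.
  by rewrite lef_pV2 ?posrE // ler_nat ltnS.
by rewrite (le_trans xm) // ler_nat.
Qed.

Lemma bigcup_compact_core U : open U -> \bigcup_n compact_core U n = U.
Proof.
move=> oU; apply/seteqP; split=> [x [n _]|x Ux]; first exact: compact_core_sub.
have /nbhs_ballP[e /= e0 eU] : nbhs x U by exact: open_nbhs_nbhs.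
have xk : (`|x| < (Num.bound `|x|)%:R)%R by apply: archi_boundP.
have ek : (e^-1 < (Num.bound e^-1)%:R)%R by apply: archi_boundP; rewrite invr_ge0 ltW.
exists (maxn (Num.bound `|x|) (Num.bound e^-1)) => //; split.
  move=> y Uy yx; apply: Uy; apply: eU; apply: ball_sym; apply: le_ball yx.
  rewrite -[leRHS]invrK lef_pV2 ?posrE ?invr_gt0 //.
  by rewrite (le_trans (ltW ek)) // ler_nat leqW // leq_maxr.
by rewrite (le_trans (ltW xk)) // ler_nat leq_maxl.
Qed.

Section Regularity.
Variable mu : {measure set (borelRd R d) -> \bar R}.

Lemma compact_core_cvg U : open U ->
  mu (compact_core U n) @[n --> \oo] --> mu U.
Proof.
move=> oU; rewrite -[in X in _ --> X](bigcup_compact_core oU).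
apply: (@nondecreasing_cvg_mu _ (borelRd R d)).
- by move=> i; apply: closed_measurable_borelRd; exact: compact_core_closed.
- by rewrite bigcup_compact_core //; exact: open_measurable_borelRd.
- exact: compact_core_nondecreasing.
Qed.

Definition closed_open_approx (A : set (borelRd R d)) := forall e : R, (0 < e)%R ->
  exists F U : set 'rV[R]_d,
    [/\ closed F, open U, F `<=` A, A `<=` U & mu (U `\` F) <= e%:E].

Hypothesis mu_fin : mu setT < +oo.

Let mu_lty (A : set (borelRd R d)) : measurable A -> mu A < +oo.
Proof.
by move=> mA; apply: le_lt_trans mu_fin; apply: le_measure; rewrite ?inE.
Qed.

Lemma open_closed_open_approx U : open U -> closed_open_approx U.
Proof.
move=> oU e e0.
have mU : measurable (U : set (borelRd R d)) by exact: open_measurable_borelRd.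
have mK n : measurable (compact_core U n : set (borelRd R d)).
  by apply: closed_measurable_borelRd; exact: compact_core_closed.
have fU : mu U \is a fin_num by rewrite ge0_fin_numE //; exact: mu_lty.
have fK n : mu (compact_core U n) \is a fin_num.
  by rewrite ge0_fin_numE //; exact: mu_lty.
have lt_U : mu U - e%:E < mu U by rewrite lteBlDr // lteDl // lte_fin.
have := compact_core_cvg oU.
move/(_ _ (open_ereal_gt' lt_U))=> [n _ /(_ n (leqnn n))] /= ltn.
exists (compact_core U n), U; split=> //.
- exact: compact_core_closed.
- exact: compact_core_sub.
rewrite measureD ?mu_lty // setIidr; last exact: compact_core_sub.
by move: (ltW ltn); rewrite EFinN !leeBlDr ?fK // addeC.
Qed.

(** The sets with this property form a sigma-algebra containing the open sets; complements exchange
    the two approximating sets. *)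
Lemma measurable_closed_open_approx (A : set (borelRd R d)) :
  measurable A -> closed_open_approx A.
Proof.
suff H : <<s @open 'rV[R]_d >> `<=` closed_open_approx by move=> /H.
apply: smallest_sub; last exact: open_closed_open_approx.
split.
- move=> e e0; exists set0, set0; rewrite setD0 measure0; split=> //.
  + exact: closed0.
  + by rewrite lee_fin ltW.
- move=> B HB e /HB[F [U [cF oU FB BU le]]]; exists (~` U), (~` F); split.
  + exact: open_closedC.
  + exact: closed_openC.
  + by move=> x Ux; split=> // /BU.
  + by move=> x [_ Bx] /FB.
  + by rewrite setDE setCK setIC -setDE.
- move=> B HB e e0.
  have /choice[FU FUP] : forall n, exists FU : set 'rV[R]_d * set 'rV[R]_d,
      [/\ closed FU.1, open FU.2, FU.1 `<=` B n, B n `<=` FU.2 &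
       mu (FU.2 `\` FU.1) <= (e / 2 / (2 ^ n.+1)%:R)%:E].
    move=> n; have [|F [U H]] := HB n (e / 2 / (2 ^ n.+1)%:R)%R.
      by rewrite !divr_gt0 // ltr0n expn_gt0.
    by exists (F, U).
  pose F n := (FU n).1; pose U n := (FU n).2.
  have mF n : measurable (F n : set (borelRd R d)).
    by apply: closed_measurable_borelRd; case: (FUP n).
  have mU n : measurable (U n : set (borelRd R d)).
    by apply: open_measurable_borelRd; case: (FUP n).
  pose V : set (borelRd R d) := \bigcup_n F n.
  have mV : measurable V by exact: bigcup_measurable.
  (* Only finite unions of the closed sets need be closed; as [mu] is finite, the rest [G n] of the
     full union has arbitrarily small mass. *)
  pose G n : set (borelRd R d) := V `\` \big[setU/set0]_(i < n) F i.
  have mG n : measurable (G n) by apply: measurableD => //; exact: bigsetU_measurable.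
  have G0 : \bigcap_n G n = set0.
    apply/seteqP; split=> // x Gx; have [[k _ Fk] _] := Gx 0%N I.
    have [_] := Gx k.+1 I; apply; rewrite -bigcup_mkord.
    by exists k => //=.
  have : mu (G n) @[n --> \oo] --> 0.
    rewrite -(measure0 mu) -G0.
    apply: (@nonincreasing_cvg_mu _ (borelRd R d)) => //.
    + exact: mu_lty.
    + by rewrite G0.
    + move=> m n mn; apply/subsetPset; apply: setDS.
      exact: subset_bigsetU.
  have e2 : 0 < (e / 2)%:E by rewrite lte_fin divr_gt0.
  move/(_ _ (open_ereal_lt' e2)) => [n _ /(_ n (leqnn n))] /= ltn.
  exists (\big[setU/set0]_(i < n) F i), (\bigcup_k U k); split.
  + by apply: closed_bigsetU => i _; case: (FUP i).
  + by apply: bigcup_open => i _; case: (FUP i).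
  + by rewrite -bigcup_mkord => x [k _ Fk]; exists k => //; case: (FUP k) => _ _ + _ _; apply.
  + by move=> x [k _ Bk]; exists k => //; case: (FUP k) => _ _ _ + _; apply.
  have mUF : measurable (\bigcup_k (U k `\` F k) : set (borelRd R d)).
    by apply: bigcup_measurable => k _; exact: measurableD.
  apply: (@le_trans _ _ (mu ((\bigcup_k (U k `\` F k)) `|` G n))).
    apply: le_measure; rewrite ?inE.
    + by apply: measurableD; [exact: bigcup_measurable | exact: bigsetU_measurable].
    + exact: measurableU.
    + move=> x [[k _ Uk] nF]; have [Vx|nV] := pselect (V x); first by right.
      by left; exists k => //; split=> // Fk; apply: nV; exists k.
  apply: (le_trans (measureU2 _ _ _)) => //.
  have -> : e = (e / 2 + e / 2)%R by lra.
  rewrite EFinD; apply: leeD; last exact: ltW.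
  apply: (@le_trans _ _ (\sum_(k <oo) mu (U k `\` F k))).
    apply: measure_sigma_subadditive => // k; exact: measurableD.
  apply: le_trans (epsilon_trick0 xpredT _); last by rewrite divr_ge0 // ltW.
  by apply: lee_nneseries => // k _; case: (FUP k).
Qed.

Lemma finite_measure_radon : is_radon mu.
Proof.
split.
- move=> K cK; apply: mu_lty; apply: closed_measurable_borelRd.
  by apply: compact_closed => //; exact: norm_hausdorff.
- move=> A mA; apply/eqP; rewrite eq_le; apply/andP; split.
    apply: le_ereal_inf_tmp => _ [U [oU AU] <-].
    by apply: le_measure; rewrite ?inE //; exact: open_measurable_borelRd.
  apply/lee_addgt0Pr => e e0.
  have [F [U [cF oU FA AU le]]] := measurable_closed_open_approx mA e0.
  have mF := closed_measurable_borelRd cF; have mU := open_measurable_borelRd oU.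
  apply: (@le_trans _ _ (mu U)); first by apply: ereal_inf_lbound; exists U.
  apply: (@le_trans _ _ (mu (A `|` (U `\` F)))).
    apply: le_measure; rewrite ?inE //.
      by apply: measurableU => //; exact: measurableD.
    move=> x Ux; have [Ax|nA] := pselect (A x); [by left | right].
    by split=> // /FA.
  apply: (le_trans (measureU2 _ _ _)) => //; first exact: measurableD.
  exact: leeD2l.
- move=> U oU; apply/eqP; rewrite eq_le; apply/andP; split.
    have /cvg_lim <- // := compact_core_cvg oU.
    apply: lime_le; first by apply/cvg_ex; exists (mu U); exact: compact_core_cvg.
    apply: nearW => n; apply: ereal_sup_ubound; exists (compact_core U n) => //.
    by split; [exact: compact_core_compact | exact: compact_core_sub].
  apply: ge_ereal_sup => _ [K [cK KU] <-]; apply: le_measure; rewrite ?inE //.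
    by apply: closed_measurable_borelRd; apply: compact_closed => //; exact: norm_hausdorff.
  exact: open_measurable_borelRd.
Qed.

End Regularity.
End FiniteBorelRadon.

(** * Nested intervals indexed by words *)

Section TreeCoding.
Context {R : realType} {D : finType}.
Variable W : seq D -> R.
Hypothesis W_ge0 : forall w, 0 <= W w.
Hypothesis W_nil : W [::] = 1.
Hypothesis W_rcons : forall w, W w = \sum_i W (rcons w i).

(** The intervals of the children of [w] are laid out in the order of [enum_rank]; this is the
    offset at which the child of rank [k] starts. *)
Let before w (k : nat) : R := \sum_(j | (enum_rank j < k)%N) W (rcons w j).

Fixpoint left_end_from (u w : seq D) : R :=
  if w is i :: w' then before u (enum_rank i) + left_end_from (rcons u i) w'
  else 0.

Definition left_end (w : seq D) : R := left_end_from [::] w.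

(** Half-open, so that the children partition their parent and a word of weight 0 gets the empty
    interval. *)
Definition word_itv (w : seq D) : set R := `[left_end w, left_end w + W w[%classic.

Lemma left_end_rcons w i :
  left_end (rcons w i) = left_end w + before w (enum_rank i).
Proof.
suff H u : left_end_from u (rcons w i) =
  left_end_from u w + before (u ++ w) (enum_rank i) by exact: H.
elim: w u => [|j w IH] u /=; first by rewrite cats0 addr0 add0r.
by rewrite IH addrA cat_rcons.
Qed.

Let beforeS w i : before w (enum_rank i).+1 = before w (enum_rank i) + W (rcons w i).
Proof.
rewrite /before (bigD1 i) //= addrC; congr (_ + _).
apply: eq_bigl => j; rewrite ltnS -(inj_eq enum_rank_inj) -val_eqE /=.
by rewrite andbC -ltn_neqAle.
Qed.

Let le_before w m n : (m <= n)%N -> before w m <= before w n.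
Proof.
move=> mn; rewrite /before [leRHS](bigID (fun j => (enum_rank j < m)%N)) /=.
rewrite [X in _ <= X + _](eq_bigl (fun j => (enum_rank j < m)%N)).
  by rewrite lerDl sumr_ge0.
move=> j; case: (ltnP (enum_rank j) m) => [jm|]; rewrite ?andbF //.
by rewrite (leq_trans jm mn).
Qed.

Lemma word_itv_child w t : word_itv w t -> exists i, word_itv (rcons w i) t.
Proof.
rewrite /word_itv /= in_itv /= => /andP[lt tr].
have exk : exists k, t < left_end w + before w k.
  exists #|D|; rewrite /before (eq_bigl xpredT) -?W_rcons // => j.
  exact: ltn_ord.
(* The child sought has rank one less than the first index whose partial sum exceeds the position of
   [t]; that index is not 0. *)
case: (ex_minnP exk) => -[|k] tk kmin.
  by move: tk; rewrite /before big1 ?addr0 // ltNge lt.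
have [kD|Dk] := ltnP k #|D|; last first.
  have /kmin : t < left_end w + before w k.
    apply: lt_le_trans tr _; rewrite lerD2l W_rcons /before.
    by rewrite [leRHS](eq_bigl xpredT) // => j; apply: leq_trans Dk; exact: ltn_ord.
  by rewrite ltnn.
exists (enum_val (Ordinal kD)); rewrite in_itv /= left_end_rcons enum_valK /=.
apply/andP; split; last first.
  have := beforeS w (enum_val (Ordinal kD)); rewrite enum_valK /= => e.
  by rewrite -addrA -e.
by rewrite leNgt; apply/negP => /kmin; rewrite ltnn.
Qed.

Lemma sub_word_itv w i : word_itv (rcons w i) `<=` word_itv w.
Proof.
move=> t; rewrite /word_itv /= !in_itv /= left_end_rcons => /andP[lt tr].
apply/andP; split.
  by apply: le_trans lt; rewrite lerDl /before sumr_ge0.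
apply: lt_le_trans tr _; rewrite -addrA lerD2l -beforeS W_rcons.
rewrite [leRHS](_ : _ = before w #|D|); first exact: le_before.
by rewrite /before; apply: eq_bigl => j; rewrite ltn_ord.
Qed.

Lemma word_itv_inj w i j t :
  word_itv (rcons w i) t -> word_itv (rcons w j) t -> i = j.
Proof.
have H a b : word_itv (rcons w a) t -> word_itv (rcons w b) t ->
    (enum_rank a < enum_rank b)%N = false.
  rewrite /word_itv /= !in_itv /= !left_end_rcons => /andP[_ ta] /andP[bt _].
  apply/negP => ab; move: (le_lt_trans bt ta); rewrite -addrA ltrD2l -beforeS.
  by rewrite ltNge le_before.
move=> ti tj; have := H _ _ ti tj; have := H _ _ tj ti.
by case: ltngtP => // /val_inj/enum_rank_inj.
Qed.

Variable i0 : D.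

Let digit w t : D := if pselect (exists i, word_itv (rcons w i) t) is left p
  then projT1 (cid p) else i0.

Let digitP w t : word_itv w t -> word_itv (rcons w (digit w t)) t.
Proof.
move=> /word_itv_child ex; rewrite /digit; case: pselect => // p.
exact: (projT2 (cid p)).
Qed.

Fixpoint itv_word t n : seq D :=
  if n is n'.+1 then rcons (itv_word t n') (digit (itv_word t n') t) else [::].

Let code t n : D := digit (itv_word t n) t.

Let itv_word_code t n : itv_word t n = mkseq (code t) n.
Proof. by elim: n => //= n IH; rewrite mkseqS -IH. Qed.

Let word_itv_nil : word_itv [::] = `[0, 1[%classic.
Proof. by rewrite /word_itv W_nil /left_end /= add0r. Qed.

Let itv_wordP t n : `[0, 1[%classic t -> word_itv (itv_word t n) t.
Proof. by move=> t01; elim: n => [|n IH] /=; [rewrite word_itv_nil | exact: digitP]. Qed.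

Let itv_word_uniq w t : word_itv w t ->
  `[0, 1[%classic t /\ itv_word t (size w) = w.
Proof.
elim/last_ind: w => [|w i IH]; first by rewrite word_itv_nil.
move=> tw; have [t01 ew] := IH (sub_word_itv tw); split=> //.
rewrite size_rcons /= ew; congr rcons.
apply: (word_itv_inj _ tw); apply: digitP; exact: sub_word_itv tw.
Qed.

(** Under the Lebesgue measure on [[0, 1[], the address [g t] is thus random and starts with [w]
    with probability [W w]. *)
Lemma tree_coding : exists g : R -> nat -> D, forall w, exists l : R,
  [set t | `[0, 1[%classic t /\ mkseq (g t) (size w) = w] = `[l, l + W w[%classic.
Proof.
exists code => w; exists (left_end w); apply/seteqP; split=> t.
  by move=> [t01 <-]; rewrite -itv_word_code; exact: itv_wordP.
by move=> /itv_word_uniq[t01 tw]; split; rewrite // -itv_word_code.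
Qed.

End TreeCoding.

(** * B-adic cells of the unit cube *)

Lemma expVn_lt {R : realType} {B : nat} (B_gt1 : (1 < B)%N) (e : R) :
  0 < e -> exists n, B%:R ^- n < e.
Proof.
move=> e0; have b_gt1 : 1 < B%:R :> R by rewrite ltr1n.
have := @cvg_geometric R 1 B%:R^-1.
rewrite ger0_norm ?invr_ge0 // invf_lt1 ?(lt_trans ltr01) // => /(_ b_gt1).
move=> /cvgr_lt /(_ _ e0)[k _ /(_ k (leqnn k))] /=.
by rewrite mul1r exprVn; exists k.
Qed.

Section Corners.
Context {R : realType} {d B : nat}.
Hypothesis B_gt1 : (1 < B)%N.
Local Notation D := {ffun 'I_d -> 'I_B}.
Implicit Types (w q : seq D) (k : 'I_d).

Fixpoint word_val w k : nat :=
  if w is i :: w' then (i k * B ^ size w' + word_val w' k)%N else 0%N.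

Lemma word_val_cat q w k :
  word_val (q ++ w) k = (word_val q k * B ^ size w + word_val w k)%N.
Proof.
elim: q => //= i q ->.
by rewrite size_cat expnD mulnDl mulnA addnA.
Qed.

Lemma word_val_lt w k : (word_val w k < B ^ size w)%N.
Proof.
elim: w => //= i w IH; rewrite expnS.
apply: (@leq_trans ((i k).+1 * B ^ size w)%N); first by rewrite mulSn addnC ltn_add2r.
by rewrite leq_mul2r ltn_ord orbT.
Qed.

Lemma word_val_inj w w' : size w = size w' ->
  (forall k, word_val w k = word_val w' k) -> w = w'.
Proof.
elim: w w' => [|i w IH] [|j w'] //= [sz] H.
have B0 : (0 < B ^ size w')%N by rewrite expn_gt0 (ltn_trans _ B_gt1).
have lt k : (word_val w k < B ^ size w')%N by rewrite -sz word_val_lt.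
congr (_ :: _).
  apply/ffunP => k; apply: val_inj => /=; have := H k; rewrite sz.
  move=> /(congr1 (fun v => v %/ B ^ size w'))%N.
  by rewrite !divnMDl // !divn_small ?addn0 ?word_val_lt.
apply: IH => // k; have := H k; rewrite sz.
move=> /(congr1 (fun v => v %% B ^ size w'))%N.
by rewrite !modnMDl !modn_small ?word_val_lt.
Qed.

Let b : R := B%:R.
Let b_gt0 : 0 < b.
Proof. by rewrite ltr0n (ltn_trans _ B_gt1). Qed.

(* The lower corner of the cell of side [B^-(size w)] of the unit cube whose
   [B]-adic expansion starts with [w]. *)
Definition corner w : 'rV[R]_d := \row_k ((word_val w k)%:R / B%:R ^+ size w).

Lemma cornerE w k : corner w ord0 k = (word_val w k)%:R / B%:R ^+ size w.
Proof. by rewrite mxE. Qed.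

Lemma corner_cat q w : corner (q ++ w) = corner q + (B%:R ^- size q) *: corner w.
Proof.
apply/rowP => k; rewrite !mxE word_val_cat size_cat natrD natrM natrX exprD.
have := b_gt0; rewrite /b => b0.
by field; rewrite !expf_neq0 ?gt_eqF.
Qed.

Lemma corner_nil : corner [::] = 0.
Proof. by apply/rowP => k; rewrite !mxE mul0r. Qed.

Lemma corner_itv w k : 0 <= corner w ord0 k < 1.
Proof.
rewrite cornerE divr_ge0 ?exprn_ge0 ?(ltW b_gt0) //=.
by rewrite ltr_pdivrMr ?exprn_gt0 // mul1r -natrX ltr_nat word_val_lt.
Qed.

Lemma corner_cat_itv q w k :
  0 <= corner (q ++ w) ord0 k - corner q ord0 k < B%:R ^- size q.
Proof.
rewrite corner_cat !mxE addrC addrK; have /andP[w0 w1] := corner_itv w k.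
rewrite cornerE in w0 w1.
have e0 : 0 < b ^- size q by rewrite invr_gt0 exprn_gt0.
by rewrite mulr_ge0 ?(ltW e0) //= gtr_pMr.
Qed.

Lemma corner_cover (x : 'rV[R]_d) n : (forall k, 0 <= x ord0 k < 1) ->
  exists w : n.-tuple D, forall k, 0 <= x ord0 k - corner w ord0 k < B%:R ^- n.
Proof.
move=> x01; elim: n => [|n [w IH]].
  by exists [tuple] => k; rewrite corner_nil mxE subr0 expr0 invr1.
(* The next digit in each coordinate is the integer part of this rescaled remainder. *)
pose y k := (x ord0 k - corner w ord0 k) * b ^+ n.+1.
have bn m : 0 < b ^+ m by rewrite exprn_gt0.
have y0 k : 0 <= y k.
  by rewrite /y mulr_ge0 ?(ltW (bn _)) //; case/andP: (IH k).
have yB k : (Num.trunc (y k) < B)%N.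
  rewrite -(ltr_nat R); apply: le_lt_trans (_ : y k < b).
    by have /andP[] := truncn_itv (y0 k).
  rewrite /y exprS mulrCA gtr_pMr // -ltr_pdivlMr // div1r.
  by case/andP: (IH k).
exists [tuple of rcons w [ffun k => Ordinal (yB k)]] => k.
rewrite /= -cats1 corner_cat !mxE /= size_tuple ffunE /= expn0 muln1 addn0 expr1.
have /andP[t1 t2] := truncn_itv (y0 k).
set t := (Num.trunc _)%:R in t1 *.
have e : x ord0 k - corner w ord0 k = y k / b ^+ n.+1 by rewrite /y mulfK ?gt_eqF.
rewrite cornerE size_tuple in e.
rewrite opprD addrA e.
have -> : b ^- n * (t / b) = t / b ^+ n.+1.
  by rewrite exprS; field; rewrite !gt_eqF.
rewrite -mulrBl divr_ge0 ?subr_ge0 ?(ltW (bn _)) //=.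
by rewrite ltr_pdivrMr // mulVf ?gt_eqF // ltrBlDl /t natr1.
Qed.

(* Two integers at distance less than 4 that agree modulo 4 are equal. *)
Lemma corner_count (y : 'rV[R]_d) n :
  \sum_(w : n.-tuple D)
     [forall k, `|y ord0 k - corner w ord0 k| < 2 * B%:R ^- n]%:R <= 4 ^+ d :> R.
Proof.
rewrite -natr_sum -[leRHS]natrX ler_nat.
pose P (w : n.-tuple D) :=
  [forall k, `|y ord0 k - corner w ord0 k| < 2 * B%:R ^- n].
have -> : (\sum_(w : n.-tuple D) P w)%N = #|[set w | P w]%SET|.
  by rewrite -sum1dep_card [RHS]big_mkcond; apply: eq_bigr => w _; case: (P w).
pose f (w : n.-tuple D) : {ffun 'I_d -> 'I_4} :=
  [ffun k => inord (word_val w k %% 4)].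
have finj : {in [set w | P w]%SET &, injective f}.
  move=> w w'; rewrite !inE => /forallP wP /forallP w'P ff.
  apply: val_inj; apply: word_val_inj; rewrite ?size_tuple // => k.
  have := congr1 (fun g : {ffun 'I_d -> 'I_4} => nat_of_ord (g k)) ff.
  rewrite !ffunE !inordK ?ltn_mod // => e4.
  have bn : 0 < b ^+ n by rewrite exprn_gt0.
  have lt4 : `|(word_val w k)%:R - (word_val w' k)%:R| < 4 :> R.
    have -> : (word_val w k)%:R - (word_val w' k)%:R =
      b ^+ n * (corner w ord0 k - corner w' ord0 k).
      by rewrite !cornerE !size_tuple -mulrBl mulrC divfK // gt_eqF.
    rewrite normrM gtr0_norm // mulrC -ltr_pdivlMr //.
    have := wP k; have := w'P k; set u := corner w _ _; set v := corner w' _ _.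
    move=> h1 h2; apply: le_lt_trans (ler_distD (y ord0 k) _ _) _.
    rewrite [`|u - _|]distrC; apply: lt_le_trans (ltrD h2 h1) _.
    by rewrite -mulrDl ler_wpM2r ?invr_ge0 ?(ltW bn) // -natrD.
  move: lt4 e4; move: (word_val w k) (word_val w' k) => u v.
  wlog uv : u v / (u <= v)%N.
    by move=> H uv4 e; case/orP: (leq_total u v) => uv; [|symmetry]; apply: H;
      rewrite // distrC.
  rewrite -normrN opprB -natrB // normr_nat (ltr_nat _ _ 4) => uv4 e.
  apply/eqP; rewrite eqn_leq uv /= -subn_eq0; apply/eqP.
  rewrite -(modn_small uv4); apply/eqP; rewrite -/(dvdn 4 (v - u)) -eqn_mod_dvd //.
  by rewrite e.
rewrite -(card_in_imset finj); apply: (leq_trans (max_card _)).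
by rewrite card_ffun !card_ord.
Qed.

Section LimitPoint.
Variable s : nat -> D.

Let c n k : R := corner (mkseq s n) ord0 k.

Let c_le m n k : c m k <= c n k + B%:R ^- n.
Proof.
have bn i : 0 < b ^- i by rewrite invr_gt0 exprn_gt0.
have H i j : (i <= j)%N -> 0 <= c j k - c i k < b ^- i.
  move=> ij; rewrite /c -(subnKC ij) /mkseq iotaD map_cat.
  have := @corner_cat_itv [seq s i | i <- iota 0 i]
    [seq s i | i <- iota (0 + i) (j - i)] k.
  by rewrite size_map size_iota.
have [nm|/ltnW mn] := leqP n m.
  by rewrite -lerBlDl; apply: ltW; case/andP: (H _ _ nm).
have /andP[+ _] := H _ _ mn; rewrite subr_ge0 => /le_trans; apply.
by rewrite lerDl ltW.
Qed.

(** The truncated expansions increase in each coordinate, so the supremum is their limit. It may lie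
    on the upper face of a cell, hence only closed cells are controlled. *)
Definition limit_point : 'rV[R]_d := \row_k sup [set corner (mkseq s n) ord0 k | n in setT].

Lemma limit_point_itv n k :
  0 <= limit_point ord0 k - corner (mkseq s n) ord0 k <= B%:R ^- n.
Proof.
rewrite mxE -/(c n k) subr_ge0; set S := [set _ | _ in _].
have ubS m : ubound S (c m k + b ^- m) by move=> _ [i _ <-]; exact: c_le.
apply/andP; split.
  by apply: ub_le_sup; [exists (c 0%N k + b ^- 0); exact: ubS | exists n].
rewrite lerBlDl; apply: ge_sup; last exact: ubS.
by exists (c 0%N k); exists 0%N.
Qed.

End LimitPoint.
End Corners.

(** * Limits of finite approximations *)

Lemma fmap_ultra {S T : Type} (f : S -> T) (F : set_system S) :
  UltraFilter F -> UltraFilter (f @ F).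
Proof.
move=> FU; split; first exact: fmap_proper_filter.
move=> G GF fFG; apply/seteqP; split=> [A GA|]; last exact: fFG.
have [//|nA] := in_ultra_setVsetC (f @^-1` A) FU.
have /(filterI GA) : G (~` A) by apply: fFG.
by rewrite setICr => /filter_not_empty.
Qed.

(** Replaces the extraction of subsequences: one and the same ultrafilter serves for the weights of
    all words and for the centres of the holes. *)
Lemma compact_ultra_cvg {S : Type} {T : topologicalType} (F : set_system S)
    (K : set T) (u : S -> T) :
  UltraFilter F -> compact K -> (forall n, K (u n)) ->
  exists2 p, K p & u @ F --> p.
Proof.
move=> FU; rewrite compact_ultra => cK Ku.
have [p [Kp up]] := cK _ (fmap_ultra u FU) (filterE _ Ku).
by exists p.
Qed.

Section Limit.
Context {R : realType} {d B : nat}.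
Hypothesis B_gt1 : (1 < B)%N.
Local Notation D := {ffun 'I_d -> 'I_B}.

(* A finite approximation, with [M] generations and tolerance [delta], of a
   probability measure on the unit cube that gives mass at most [beta ^ l] to
   the cells of generation [l] and has [alpha]-holes at all its points and all
   scales up to 1; [W w] is the mass of the cell of [w]. *)
Definition porous_config (alpha beta delta : R) (M : nat) : Prop :=
  exists W : seq D -> R,
  [/\ W [::] = 1, forall w, 0 <= W w,
      forall w, (size w < M)%N -> W w = \sum_i W (rcons w i),
      forall w, (size w <= M)%N -> W w <= beta ^+ size w
    & forall u, size u = M -> 0 < W u -> forall r, delta <= r <= 1 ->
      exists y : 'rV[R]_d, enorm (y - corner u) <= (1 - alpha) * r + delta /\
        forall u', size u' = M -> 0 < W u' ->
          alpha * r - delta <= enorm (corner u' - y)].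

(** Weight is conserved, so a word of positive weight has a child of positive weight; induction on
    the number of missing letters. *)
Lemma positive_extension (W : seq D -> R) M w :
  (forall w, 0 <= W w) ->
  (forall w, (size w < M)%N -> W w = \sum_i W (rcons w i)) ->
  (size w <= M)%N -> 0 < W w ->
  exists v, size (w ++ v) = M /\ 0 < W (w ++ v).
Proof.
move=> W0 Wr; elim: {w}(M - size w)%N {-2}w (erefl (M - size w)%N) => [|n IH] w.
  move=> /eqP; rewrite subn_eq0 => Mw wM Ww.
  by exists [::]; rewrite cats0; split=> //; apply/eqP; rewrite eqn_leq wM.
move=> Mw wM Ww; have wM' : (size w < M)%N by rewrite -subn_gt0 Mw.
have [i Wi] : exists i, 0 < W (rcons w i).
  apply: contrapT => /forallNP nW; move: Ww; rewrite (Wr _ wM') big1 ?ltxx //.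
  move=> i _; apply/eqP; rewrite eq_le W0 andbT leNgt; apply/negP; exact: nW.
have [|||v [sv Wv]] := IH (rcons w i); rewrite ?size_rcons //.
  by rewrite subnS Mw.
by exists (i :: v); rewrite -cat_rcons.
Qed.

Lemma corner_limit_point_dist (s : nat -> D) q n v :
  mkseq s n = q -> enorm (corner (q ++ v) - limit_point s) <= d%:R * B%:R ^- n :> R.
Proof.
move=> qE; have sq : size q = n by rewrite -qE size_mkseq.
have b0 : 0 < B%:R ^- n :> R by rewrite invr_gt0 exprn_gt0 // ltr0n ltnW.
apply: enorm_le_coord; first exact: ltW.
move=> k; rewrite !mxE.
have := @limit_point_itv R d B B_gt1 s n k; have := @corner_cat_itv R d B B_gt1 q v k.
rewrite qE sq !mxE; set a := (_ / _); set b := (_ / _); set c := sup _.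
by move=> /andP[h1 h2] /andP[h3 h4]; rewrite ler_norml; apply/andP; split; lra.
Qed.

Definition positive_branch (W : seq D -> R) (s : nat -> D) :=
  forall n, 0 < W (mkseq s n).

(** Weights for tolerances tending to 0 converge along an ultrafilter, and the holes become exact in
    the limit. They are obtained on a closure because a closed set has a measurable complement, as
    the almost-everywhere statement of porosity requires. *)
Lemma limit_config (alpha beta : R) : 0 < alpha <= 1 -> 0 <= beta <= 1 ->
  (forall delta, 0 < delta -> exists M, B%:R ^- M <= delta /\
    porous_config alpha beta delta M) ->
  exists W : seq D -> R,
  [/\ W [::] = 1, forall w, 0 <= W w, forall w, W w = \sum_i W (rcons w i),
      forall w, W w <= beta ^+ size w
    & forall x, closure [set limit_point s | s in positive_branch W] x ->
      forall r, 0 < r <= 1 ->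
      exists y : 'rV[R]_d, enorm (y - x) <= (1 - alpha) * r /\
        forall t, positive_branch W t -> alpha * r <= enorm (limit_point t - y)].
Proof.
move=> /andP[a0 a1] /andP[b0 b1] H.
have b_gt1 : 1 < B%:R :> R by rewrite ltr1n.
have b_gt0 : 0 < B%:R :> R by rewrite ltr0n ltnW.
pose dl (n : nat) : R := n.+1%:R^-1.
have dl0 n : 0 < dl n by rewrite invr_gt0.
have /choice[MW MWP] : forall n : nat, exists MW : nat * (seq D -> R),
  B%:R ^- MW.1 <= dl n /\ [/\ MW.2 [::] = 1, forall w, 0 <= MW.2 w,
      forall w, (size w < MW.1)%N -> MW.2 w = \sum_i MW.2 (rcons w i),
      forall w, (size w <= MW.1)%N -> MW.2 w <= beta ^+ size w
    & forall u, size u = MW.1 -> 0 < MW.2 u -> forall r, dl n <= r <= 1 ->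
      exists y : 'rV[R]_d, enorm (y - corner u) <= (1 - alpha) * r + dl n /\
        forall u', size u' = MW.1 -> 0 < MW.2 u' ->
          alpha * r - dl n <= enorm (corner u' - y)].
  by move=> n; have [M [BM [W WP]]] := H _ (dl0 n); exists (M, W).
pose M n := (MW n).1; pose W n := (MW n).2.
have [U [UU sU]] := @ultraFilterLemma nat \oo _.
have dlU e : 0 < e -> \forall n \near U, dl n < e.
  by move=> e0; apply: sU; exact: (near_infty_natSinv_lt (PosNum e0)).
have MU k : \forall n \near U, (k <= M n)%N.
  have : 0 < B%:R ^- k :> R by rewrite invr_gt0 exprn_gt0.
  move=> /dlU; apply: filterS => n lt; have [BM _] := MWP n.
  rewrite leqNgt; apply/negP => Mk; move: (le_lt_trans BM lt).
  rewrite ltf_pV2 ?posrE ?exprn_gt0 // ltr_eXn2l // => kM.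
  by move: (ltn_trans Mk kM); rewrite ltnn.
(* [W n] is controlled up to generation [M n] only. Cut off there, it takes values in [[0, 1]]; for
   a fixed word the cut-off disappears eventually, as [M n] tends to infinity. *)
pose V n w := if (size w <= M n)%N then W n w else 0.
have V01 w n : `[0, 1]%classic (V n w).
  rewrite /= in_itv /= /V; case: leqP => [sw|]; last by rewrite lexx ler01.
  have [_ [_ W0 _ Wb _]] := MWP n; rewrite W0 /=.
  by apply: (le_trans (Wb _ sw)); rewrite exprn_ile1.
have /choice[X XP] : forall w, exists x : R, `[0, 1]%classic x /\ V n w @[n --> U] --> x.
  move=> w; have [x x01 xU] := compact_ultra_cvg UU (@segment_compact _ 0 1) (V01 w).
  by exists x.
have VW w : \forall n \near U, V n w = W n w.
  by apply: filterS (MU (size w)) => n; rewrite /V => ->.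
have X0 w : 0 <= X w.
  by have [+ _] := XP w; rewrite /= in_itv /= => /andP[].
exists X; split=> //.
- have [_ c] := XP [::]; apply: (@cvg_unique _ _ (V n [::] @[n --> U])) => //.
  apply: cvg_near_cst; apply: filterS (VW [::]) => n ->.
  by have [_ []] := MWP n.
- move=> w; have [_ c] := XP w.
  apply: (@cvg_unique _ _ (V n w @[n --> U])) => //.
  have : \sum_i V n (rcons w i) @[n --> U] --> \sum_i X (rcons w i).
    by apply: cvg_big => [|i _]; [exact: add_continuous | exact: (XP _).2].
  apply: cvg_trans; apply: near_eq_cvg.
  apply: filterS (MU (size w).+1) => n sw.
  have [_ [_ _ Wr _ _]] := MWP n; rewrite /V (ltnW sw) [RHS](Wr _ sw).
  by apply: eq_bigr => i _; rewrite size_rcons sw.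
- move=> w; have [_ c] := XP w; apply: (cvgr_to_le c).
  apply: filterS (MU (size w)) => n sw; rewrite /V sw.
  by have [_ [_ _ _ Wb _]] := MWP n; exact: Wb.
move=> x Ex r /andP[r0 r1].
(* A single approximation gives a hole up to any error [e]; the centres for errors tending to 0 then
   converge along the ultrafilter. *)
have approx e : 0 < e -> exists y : 'rV[R]_d,
    enorm (y - x) <= (1 - alpha) * r + e /\
    forall t, positive_branch X t -> alpha * r - e <= enorm (limit_point t - y).
  move=> e0.
  have [_ [[s sX <-] sx]] : [set limit_point s | s in positive_branch X] `&`
      eball x (e / 2) !=set0.
    apply: Ex; apply: open_nbhs_nbhs; split; first exact: eball_open.
    by rewrite /eball /= subrr enorm0 divr_gt0.
  rewrite /eball /= in sx.
  have [k kP] : exists k, d%:R * B%:R ^- k <= e / 4 :> R.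
    have e2 : 0 < e / 4 / d.+1%:R by rewrite !divr_gt0.
    have [k] := expVn_lt B_gt1 e2; rewrite ltr_pdivlMr // => lt; exists k.
    rewrite mulrC; apply: le_trans (ltW lt).
    by rewrite ler_wpM2l ?invr_ge0 ?exprn_ge0 ?(ltW b_gt0) // ler_nat.
  (* There are finitely many words of length [k], so one [n] serves for the prefixes of all positive
     branches. *)
  have posU : \forall n \near U, forall w : k.-tuple D, 0 < X w -> 0 < V n w.
    apply: filter_forall => w; have [->|Xn] := eqVneq (X w) 0.
      by apply: filterE => n; rewrite ltxx.
    have Xw : 0 < X w by rewrite lt_neqAle eq_sym Xn X0.
    have gtw : \forall n \near U, 0 < V n w by exact: (cvgr_gt _ (XP w).2).
    by apply: filterS gtw => n Vn _.
  have e2 : 0 < Num.min (e / 4) r by rewrite lt_min r0 divr_gt0.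
  have [n [[nV nd] nM]] := filter_ex (filterI (filterI posU (dlU _ e2)) (MU k)).
  move: nd; rewrite lt_min => /andP[nd nr].
  have [BM [_ W0 Wr _ Wh]] := MWP n.
  have ext t : positive_branch X t -> exists v,
      [/\ size (mkseq t k ++ v) = M n, 0 < W n (mkseq t k ++ v) &
      enorm (corner (mkseq t k ++ v) - limit_point t) <= e / 4 :> R].
    move=> tX; have szt : size (mkseq t k) == k by rewrite size_mkseq.
    have := nV (Tuple szt) (tX k); rewrite /V /= size_mkseq nM => Wt.
    have [|v [sv Wv]] := positive_extension W0 Wr _ Wt; first by rewrite size_mkseq.
    exists v; split=> //; apply: le_trans kP; exact: corner_limit_point_dist.
  have [v [sv Wv dv]] := ext _ sX.
  have [|y [yu yu']] := Wh _ sv Wv r; first by rewrite r1 ltW.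
  exists y; split.
    apply: (le_trans (enorm_triangle (corner (mkseq s k ++ v)) _ _)).
    have := enorm_triangle (limit_point s) (corner (mkseq s k ++ v)) x.
    by move: nd yu dv sx; lra.
  move=> t tX; have [v' [sv' Wv' dv']] := ext _ tX.
  have := enorm_triangle (limit_point t) (corner (mkseq t k ++ v')) y.
  by have := yu' _ sv' Wv'; move: nd dv'; lra.
have /choice[y yP] := fun n => approx _ (dl0 n).
(* The centres are within [(1 - alpha) * r + dl n <= 2] of [x]. *)
pose C : R := `|x| + 2.
pose K : set 'rV[R]_d := [set x | `|x| <= C].
have cK : compact K by exact: compact_norm_le.
have yK n : K (y n).
  rewrite /K /= /C; have [yn _] := yP n; have := norm_le_enorm (y n - x).
  have dl1 : dl n <= 1 by rewrite invf_le1 // ler1n.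
  have := ler_normD (y n - x) x; rewrite subrK.
  have : (1 - alpha) * r <= 1 by nra.
  lra.
have [z _ yz] := compact_ultra_cvg UU cK yK.
have close e : 0 < e -> exists n, dl n < e /\ enorm (y n - z) < e.
  move=> e0; have e1 : 0 < e / d.+1%:R by rewrite divr_gt0.
  have near_y : \forall n \near U, enorm (y n - z) < e.
    have zN : nbhs z [set x | enorm (x - z) < e].
      apply: open_nbhs_nbhs; split; first exact: (@eball_open _ _ z e).
      by rewrite /= subrr enorm0.
    exact: yz zN.
  by have [n [h1 h2]] := filter_ex (filterI (dlU _ e0) near_y); exists n.
exists z; split.
  apply/ler_addgt0Pr => e e0.
  have e2 : 0 < e / 2 by rewrite divr_gt0.
  have [n [dn zn]] := close _ e2; have [yn _] := yP n.
  have := enorm_triangle (y n) z x; rewrite [enorm (z - y n)]enormB.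
  lra.
move=> t tX; apply/ler_addgt0Pr => e e0.
have e2 : 0 < e / 2 by rewrite divr_gt0.
have [n [dn zn]] := close _ e2; have [_ /(_ t tX) yn] := yP n.
have := enorm_triangle z (limit_point t) (y n); rewrite [enorm (z - y n)]enormB.
lra.
Qed.

End Limit.

(** * Measures coded by weights on words *)

Section LocalDimension.
Context {R : realType}.
Implicit Types (r a : R) (m : \bar R).
Local Open Scope ereal_scope.

Let ln_lt0' r : (0 < r < 1)%R -> (ln r < 0)%R.
Proof. by move=> r01; rewrite ln_lt0. Qed.

(** Division by [ln r < 0] reverses the inequality between logarithms; for [m = 0] the quotient is
    [+oo]. *)
Lemma le_lne_ratio r a m : (0 < r < 1)%R -> 0 <= m -> m <= (r `^ a)%:E ->
  a%:E <= lne m / (ln r)%:E.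
Proof.
move=> r01 m0 mr; have lr := ln_lt0' r01; have /andP[r0 _] := r01.
rewrite inver lt_eqF //; move: m0 mr; case: m => [x| |] //.
rewrite !lee_fin => x0 xr; have [->|xn] := eqVneq x 0%R.
  by rewrite le0_lneNy // lt0_mulNye ?leey // lte_fin invr_lt0.
have {}x0 : (0 < x)%R by rewrite lt_neqAle eq_sym xn.
rewrite lne_EFin // -EFinM lee_fin ler_ndivlMr //.
rewrite -ln_powR ler_ln ?posrE ?powR_gt0 //.
Qed.

Lemma lt_lne_ratio r a m : (0 < r < 1)%R -> 0 <= m ->
  a%:E < lne m / (ln r)%:E -> m <= (r `^ a)%:E.
Proof.
move=> r01 m0; have lr := ln_lt0' r01; have /andP[r0 _] := r01.
rewrite inver lt_eqF //; move: m0; case: m => [x| |] //; last first.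
  by rewrite /= lt0_mulye // lte_fin invr_lt0.
rewrite !lee_fin => x0; have [->|xn] := eqVneq x 0%R; first by rewrite powR_ge0.
have {}x0 : (0 < x)%R by rewrite lt_neqAle eq_sym xn.
rewrite lne_EFin // -EFinM lte_fin ltr_ndivlMr // => /ltW.
by rewrite -ln_powR ler_ln ?posrE ?powR_gt0.
Qed.

End LocalDimension.

Lemma measure_bigsetU_le {dT} {T : measurableType dT} {R : realType}
    (mu : {measure set T -> \bar R}) (I : Type) (r : seq I) (P : pred I)
    (F : I -> set T) : (forall i, measurable (F i)) ->
  (mu (\big[setU/set0]_(i <- r | P i) F i) <= \sum_(i <- r | P i) mu (F i))%E.
Proof.
move=> mF; elim: r => [|i r IH]; first by rewrite !big_nil measure0.
rewrite !big_cons; case: ifP => // _; apply: le_trans (leeD2l _ IH).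
by apply: measureU2 => //; exact: bigsetU_measurable.
Qed.

Section CodedMeasure.
Context {R : realType} {d B : nat}.
Hypothesis B_gt1 : (1 < B)%N.
Local Notation D := {ffun 'I_d -> 'I_B}.
Variable W : seq D -> R.
Hypothesis W_ge0 : forall w, 0 <= W w.
Hypothesis W_nil : W [::] = 1.
Hypothesis W_rcons : forall w, W w = \sum_i W (rcons w i).

(* The push-forward of the Lebesgue measure on [0, 1[ by the map that sends the
   point of [0, 1[ with a given address in the nested partition into intervals of
   lengths [W w] to the point of the cube with the same address. *)
Lemma coded_measure : exists mu : {measure set (borelRd R d) -> \bar R},
  [/\ mu setT = 1%E,
      forall A : set 'rV[R]_d, measurable (A : set (borelRd R d)) ->
        (forall s, positive_branch W s -> ~ A (limit_point s)) -> mu A = 0%E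
    & forall (A : set 'rV[R]_d) n (P : pred (n.-tuple D)),
        measurable (A : set (borelRd R d)) ->
        (forall s (w : n.-tuple D), A (limit_point s) -> mkseq s n = w -> P w) ->
        (mu A <= (\sum_(w : n.-tuple D) (P w)%:R * W w)%:E)%E].
Proof.
pose i0 : D := [ffun=> Ordinal (ltnW B_gt1)].
have [g gP] := tree_coding W_ge0 W_nil W_rcons i0.
pose I01 : set R := `[0, 1[%classic.
pose cyl (w : seq D) : set R := [set t | I01 t /\ mkseq (g t) (size w) = w].
have mcyl w : measurable (cyl w).
  by have [l cE] := gP w; rewrite /cyl cE; exact: measurable_itv.
have lcyl w : lebesgue_measure (cyl w) = (W w)%:E.
  have [l cE] := gP w; rewrite /cyl cE lebesgue_measure_itv /= lte_fin.
  rewrite -EFinD addrAC subrr add0r ltrDl.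
  case: ltP => // W0; congr EFin; apply/eqP; by rewrite eq_le W_ge0.
(* A prefix of weight 0 has an empty interval, so it never occurs in an address. *)
have cyl_pos t : I01 t -> positive_branch W (g t).
  move=> t01 n; rewrite lt_neqAle W_ge0 andbT; apply/eqP => W0.
  have : cyl (mkseq (g t) n) t by split=> //; rewrite size_mkseq.
  by rewrite /cyl; have [l ->] := gP (mkseq (g t) n); rewrite -W0 addr0 set_itvxx.
pose f (t : R) : borelRd R d := if t \in I01 then limit_point (g t) else 0.
have fE t : I01 t -> f t = limit_point (g t) by move=> t01; rewrite /f mem_set.
have mI : measurable I01 by exact: measurable_itv.
have mf : @measurable_fun _ _ (measurableTypeR R) (borelRd R d) setT f.
  apply: (@measurability _ _ (measurableTypeR R) (borelRd R d) setT f (@open 'rV[R]_d)).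
    by [].
  move=> _ [U oU <-]; rewrite setTI.
  (* A cylinder is sent into the closed cell of its word. Hence the preimage of [U] is the union of
     the cylinders whose closed cells lie in [U], up to the points outside [[0, 1[], which are sent
     to 0. *)
  pose inU n := [set w : n.-tuple D | forall y : 'rV[R]_d,
    (forall k, 0 <= y ord0 k - corner w ord0 k <= B%:R ^- n) -> U y].
  have -> : f @^-1` U =
     (\bigcup_n \bigcup_(w in inU n) cyl w) `|` (~` I01 `&` [set t | U 0]).
    apply/seteqP; split=> t.
      have [t01|t01] := pselect (I01 t); last first.
        by move=> Ut; right; split=> //; move: Ut; rewrite /preimage /= /f memNset.
      rewrite /preimage /= fE // => Ut; left.
      have /nbhs_ballP[e /= e0 eU] : nbhs (limit_point (g t)) U by exact: open_nbhs_nbhs.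
      have /(expVn_lt B_gt1)[n Bn] : 0 < e / 2 by rewrite divr_gt0.
      have szt : size (mkseq (g t) n) == n by rewrite size_mkseq.
      exists n => //; exists (Tuple szt); last by split=> //=; rewrite size_mkseq.
      move=> y yP; apply: eU; apply/rV_ballE => // k.
      have := yP k; have := @limit_point_itv R d B B_gt1 (g t) n k.
      move: Bn; rewrite /=; set u := _ ord0 k; set v := _ ord0 k; set z := _ ord0 k.
      by move=> Bn /andP[h1 h2] /andP[h3 h4]; rewrite ltr_norml; apply/andP; split; lra.
    move=> [[n _ [w wU [t01 tw]]]|[t01 U0]]; last by rewrite /preimage /= /f memNset.
    rewrite /preimage /= fE //; apply: wU => k.
    by rewrite -tw size_tuple; exact: limit_point_itv.
  apply: measurableU.
    apply: bigcup_measurable => n _; apply: fin_bigcup_measurable => //.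
    by move=> w _; exact: mcyl.
  apply: measurableI; first exact: measurableC.
  have [U0|nU0] := pselect (U 0).
    by have -> : [set t : R | U 0] = setT by apply/seteqP; split.
  by have -> : [set t : R | U 0] = set0 by apply/seteqP; split=> t //.
pose nu := mrestr (@lebesgue_measure R) mI.
have [mu muE] : exists mu : {measure set (borelRd R d) -> \bar R},
    forall A, mu A = lebesgue_measure (f @^-1` A `&` I01).
  by exists (measure_function_pushforward__canonical__measure_function_Measure nu mf).
exists mu; split.
- by rewrite muE preimage_setT setTI lebesgue_measure_itv /= lte_fin ltr01 oppr0 adde0.
- move=> A mA sA; rewrite muE.
  have -> : f @^-1` A `&` I01 = set0; last by rewrite measure0.
  apply/seteqP; split=> // t [At t01]; apply: (sA _ (cyl_pos _ t01)).
  by rewrite -fE.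
- move=> A n P mA AP; rewrite muE.
  pose F (w : n.-tuple D) : set (measurableTypeR R) := cyl w.
  apply: (@le_trans _ _ (lebesgue_measure
      (\big[setU/set0]_(w : n.-tuple D | P w) F w : set (measurableTypeR R)))).
    apply: le_measure; rewrite ?inE.
    + by apply: measurableI => //; rewrite -[X in measurable X]setTI; exact: mf.
    + by apply: bigsetU_measurable => w _; exact: mcyl.
    + move=> t [At t01].
      have szt : size (mkseq (g t) n) == n by rewrite size_mkseq.
      have Pw : P (Tuple szt) by apply: (AP (g t)); rewrite // -fE.
      rewrite (bigD1 (Tuple szt)) //=; left; split=> //=.
      by rewrite size_mkseq.
  apply: (le_trans (measure_bigsetU_le _ _ _ _)) => [w|]; first exact: mcyl.
  rewrite -sumEFin big_mkcond /= le_eqVlt; apply/orP; left; apply/eqP.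
  by apply: eq_bigr => w _; rewrite lcyl; case: (P w); rewrite ?mul1r ?mul0r.
Qed.

End CodedMeasure.

(** * Dimension of the limit measure *)

Section DeltaLowerBound.
Context {R : realType} {d B : nat}.
Hypothesis B_gt1 : (1 < B)%N.
Local Notation D := {ffun 'I_d -> 'I_B}.
Local Open Scope ereal_scope.

Lemma powR_cell (a : R) n :
  ((B%:R ^- n) `^ a = (B%:R `^ (- a)) ^+ n :> R)%R.
Proof.
rewrite -powR_invn ?ler0n // -!powRrM mulrC -[RHS]powR_mulrn ?powR_ge0 //.
by rewrite -powRrM mulrN mulNr mulrC.
Qed.

(** As [mu] is not zero, what holds almost everywhere holds at some point; an essential upper bound
    is therefore at least one of the values. *)
Lemma le_upper_packing_dim (mu : {measure set (borelRd R d) -> \bar R}) (a : \bar R) :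
  mu setT != 0 -> (forall x, a <= upper_local_dim mu x) ->
  a <= upper_packing_dim mu.
Proof.
move=> mu0 Ha; apply: le_ereal_inf_tmp => y /= aey.
have FF : ProperFilter (almost_everywhere mu).
  by apply: ae_properfilter_algebraOfSetsType; rewrite lt_neqAle eq_sym mu0 measure_ge0.
by have [x] := filter_ex aey; apply: le_trans.
Qed.

(** An upper limit may be tested along the radii [B^-n], and the strict inequality on [beta] absorbs
    the constant [C]. *)
Lemma le_upper_local_dim (mu : {measure set (borelRd R d) -> \bar R}) (x : 'rV[R]_d)
    (a beta C : R) : (0 <= beta < B%:R `^ (- a))%R ->
  (forall n, mu (eball x (B%:R ^- n)) <= (C * beta ^+ n)%:E) ->
  a%:E <= upper_local_dim mu x.
Proof.
move=> /andP[b0 ba] H; apply: le_ereal_inf_tmp => _ [V V0 <-].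
have [e /= e0 eV] := V0.
have c0 : (0 < B%:R `^ (- a) :> R)%R by apply: le_lt_trans ba.
pose q : R := (beta / B%:R `^ (- a))%R.
have q0 : (0 <= q)%R by rewrite divr_ge0 // ltW.
have q1 : (`|q| < 1)%R by rewrite ger0_norm // ltr_pdivrMr // mul1r.
have [N _ NP] := cvgr_lt _ (cvg_geometric C q1) _ ltr01.
have [m mP] := expVn_lt B_gt1 e0.
have bg1 : (1 < B%:R :> R)%R by rewrite ltr1n.
have bg0 : (0 < B%:R :> R)%R by rewrite (lt_trans ltr01).
(* [N] absorbs [C], [m] brings [r] below [e], and the successor makes [n] positive, so that
   [r < 1]. *)
pose n := maxn N m.+1; pose r : R := (B%:R ^- n)%R.
have r0 : (0 < r)%R by rewrite invr_gt0 exprn_gt0.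
have r1 : (r < 1)%R.
  rewrite invf_lt1 ?exprn_gt0 // exprn_egt1 // -lt0n /n.
  by case: maxn (leq_maxr N m.+1).
have rm : (r < e)%R.
  apply: le_lt_trans mP; rewrite lef_pV2 ?posrE ?exprn_gt0 //.
  by rewrite ler_weXn2l ?(ltW bg1) // ltnW // leq_maxr.
apply: le_ereal_sup_tmp; exists (lne (mu (eball x r)) / (ln r)%:E).
  by exists r => //; apply: eV => //=; rewrite sub0r normrN gtr0_norm.
apply: le_lne_ratio; [by rewrite r0 r1 | exact: measure_ge0 |].
apply: (le_trans (H n)); rewrite lee_fin powR_cell.
have /= := NP n (leq_maxl _ _).
by rewrite /geometric /= /q expr_div_n mulrA ltr_pdivrMr ?exprn_gt0 // mul1r => /ltW.
Qed.

(** The measure coded by the limit weight vanishes on the holes, so it is porous for every fraction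
    [e]. A ball of radius [B^-n] sees at most [4 ^+ d] cells of generation [n], each of mass at most
    [beta ^+ n], which bounds the local dimensions from below. *)
Lemma le_Delta_of_configs (alpha beta a : R) : (0 < alpha <= 1)%R ->
  (0 <= beta <= 1)%R -> (beta < B%:R `^ (- a))%R ->
  (forall delta : R, (0 < delta)%R -> exists M, (B%:R ^- M <= delta)%R /\
    @porous_config R d B alpha beta delta M) ->
  a%:E <= Delta d alpha.
Proof.
move=> alpha01 beta01 ba conf; have /andP[alpha0 alpha1] := alpha01.
have [W [W_nil W0 Wr Wb Wh]] := limit_config B_gt1 alpha01 beta01 conf.
have [mu [muT mu0 mub]] := coded_measure B_gt1 W0 W_nil Wr.
apply: le_ereal_sup_tmp; exists (upper_packing_dim mu).
  exists mu => //; split; first by apply: finite_measure_radon; rewrite muT ltry.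
  pose E : set 'rV[R]_d := closure [set limit_point s | s in positive_branch W].
  have mE : measurable (~` E : set (borelRd R d)).
    apply: open_measurable_borelRd; apply: closed_openC; exact: closed_closure.
  exists (~` E); split=> //.
    apply: mu0 => // s sW; apply; apply: subset_closure; by exists s.
  apply: subsetC => x Ex; near=> e; near=> r.
  have r0 : (0 < r)%R by near: r; exact: nbhs_right_gt.
  have r1 : (r <= 1)%R by near: r; exact: nbhs_right_le.
  have [|y [yx yh]] := Wh x Ex r; first by rewrite r0 r1.
  exists y; split.
    by apply: eball_subset; apply: le_trans yx _; rewrite mulrBl mul1r.
  rewrite mu0.
  - by rewrite mule_ge0 // lee_fin ltW.
  - by apply: open_measurable_borelRd; exact: eball_open.
  - by move=> s /yh; rewrite leNgt /eball /= => /negP.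
apply: le_upper_packing_dim => [|x]; first by rewrite muT oner_neq0.
have /andP[beta0 _] := beta01.
apply: (@le_upper_local_dim _ _ _ beta (4 ^+ d)); first by rewrite beta0.
move=> n.
pose P (w : n.-tuple D) := [forall k, `|x ord0 k - corner w ord0 k| < 2 * B%:R ^- n]%R.
apply: (le_trans (mub _ n P _ _)).
- by apply: open_measurable_borelRd; exact: eball_open.
- move=> s w sx sw; apply/forallP => k.
  have := @limit_point_itv R d B B_gt1 s n k; rewrite sw.
  move: sx; rewrite /eball /= enormB => /(le_lt_trans (coord_le_enorm _ k)).
  rewrite !mxE; set u := x _ _; set v := sup _; set z := (_%:R / _)%R.
  rewrite !ltr_norml => /andP[h1 h2] /andP[h3 h4]; apply/andP; split; lra.
rewrite lee_fin; apply: (@le_trans _ _ (\sum_(w : n.-tuple D) (P w)%:R * beta ^+ n))%R.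
  apply: ler_sum => w _; apply: ler_wpM2l => //.
  by apply: le_trans (Wb w) _; rewrite size_tuple.
rewrite -mulr_suml; apply: ler_wpM2r; first exact: exprn_ge0.
exact: corner_count.
Unshelve. all: by end_near. Qed.

End DeltaLowerBound.

(** * Masses of cubes *)

Lemma corner_le {R : realType} {d B : nat} (B_gt1 : (1 < B)%N)
    (w : seq {ffun 'I_d -> 'I_B}) k :
  corner w ord0 k <= 1 - B%:R ^- size w :> R.
Proof.
have b0 : 0 < B%:R ^+ size w :> R by rewrite exprn_gt0 // ltr0n ltnW.
rewrite cornerE lerBrDr -[X in _ + X]mul1r -mulrDl ler_pdivrMr // mul1r natr1 -natrX ler_nat.
exact: word_val_lt.
Qed.

(** Integrate over [U] the bound on the number of sets [F i] that contain a given point. *)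
Lemma sum_measure_le {dT} {T : measurableType dT} {R : realType}
    (mu : {measure set T -> \bar R}) (I : finType) (F : I -> set T) (U : set T)
    (K : R) : 0 <= K -> measurable U -> (forall i, measurable (F i)) ->
  (forall i, F i `<=` U) ->
  (forall x, \sum_i \1_(F i) x <= K) ->
  (\sum_i mu (F i) <= K%:E * mu U)%E.
Proof.
move=> K0 mU mF FU FK.
have mi i : measurable_fun U (fun x => (\1_(F i) x)%:E : \bar R).
  by apply/measurable_EFinP; exact: measurable_indic.
under eq_bigr => i _.
  rewrite -[F i](setIidl (FU i)) -(integral_indic mu mU (mF i)); over.
rewrite -ge0_integral_sum //.
have <- : (\int[mu]_(x in U) K%:E = K%:E * mu U)%E by exact: integral_cst.
apply: ge0_le_integral => //.
- by move=> x _; apply: sume_ge0 => i _; rewrite lee_fin.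
- exact: emeasurable_sum.
- by move=> x _; rewrite sumEFin lee_fin.
Qed.

Section Cubes.
Context {R : realType} {d B : nat}.
Hypothesis B_gt1 : (1 < B)%N.
Local Notation D := {ffun 'I_d -> 'I_B}.
Implicit Types (p x : 'rV[R]_d) (s : R) (w q : seq D).

Let b_gt0 : 0 < B%:R :> R. Proof. by rewrite ltr0n ltnW. Qed.

(** The cells of the unit cube, transported to the cube with lower corner [p] and side [s]. *)
Definition child_corner p s w : 'rV[R]_d := p + s *: corner w.
Definition child_side s w : R := s * B%:R ^- size w.

Lemma child_cornerE p s w k :
  child_corner p s w ord0 k = p ord0 k + s * corner w ord0 k.
Proof. by rewrite /child_corner !mxE. Qed.

Lemma child_side_gt0 s w : 0 < s -> 0 < child_side s w.
Proof. by move=> s0; rewrite mulr_gt0 // invr_gt0 exprn_gt0. Qed.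

Lemma child_side_cat s q w : child_side s (q ++ w) = child_side (child_side s q) w.
Proof. by rewrite /child_side size_cat exprD invfM mulrA. Qed.

Lemma child_corner_cat p s q w :
  child_corner p s (q ++ w) = child_corner (child_corner p s q) (child_side s q) w.
Proof. by rewrite /child_corner corner_cat // scalerDr addrA scalerA. Qed.

Lemma child_side_le s w : 0 <= s -> child_side s w <= s.
Proof.
move=> s0; rewrite /child_side ler_piMr // invf_le1 ?exprn_gt0 //.
by rewrite exprn_ege1 // ler1n ltnW.
Qed.

Definition cell p s : set 'rV[R]_d := [set x | forall k, 0 <= x ord0 k - p ord0 k < s].

Lemma child_cell_sub p s w : 0 < s ->
  cell (child_corner p s w) (child_side s w) `<=` cell p s.
Proof.
move=> s0 x H k; have := H k; have := corner_le (R := R) B_gt1 w k.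
have /andP[c0 _] := @corner_itv R d B B_gt1 w k.
rewrite child_cornerE /child_side.
move: c0; set c := corner w _ _; set e := _ ^- _ => c0 c1 /andP[h1 h2].
have := mulr_ge0 (ltW s0) c0; have := ler_wpM2l (ltW s0) c1.
by rewrite mulrBr mulr1 => h3 h4; apply/andP; split; lra.
Qed.

Lemma cell_cover p s n x : 0 < s -> cell p s x ->
  exists w : n.-tuple D, cell (child_corner p s w) (child_side s w) x.
Proof.
move=> s0 H.
have [|w wP] := @corner_cover R d B B_gt1 (s^-1 *: (x - p)) n.
  move=> k; rewrite !mxE; have /andP[h1 h2] := H k.
  rewrite mulr_ge0 ?invr_ge0 ?(ltW s0) //= mulrC ltr_pdivrMr // mul1r //.
exists w => k; have := wP k; rewrite child_cornerE /child_side size_tuple.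
set c := corner w _ _; set e := _ ^- _.
have -> : (s^-1 *: (x - p)) ord0 k = s^-1 * (x ord0 k - p ord0 k) by rewrite !mxE.
move=> /andP[h1 h2]; have sn : s != 0 by rewrite gt_eqF.
have -> : x ord0 k - (p ord0 k + s * c) = s * (s^-1 * (x ord0 k - p ord0 k) - c).
  by rewrite mulrBr mulrA divff // mul1r opprD addrA.
by rewrite mulr_ge0 ?(ltW s0) //= ltr_pM2l.
Qed.

Lemma child_cube_sub p s w : 0 < s ->
  ball (child_corner p s w) (2 * child_side s w) `<=` ball p (2 * s).
Proof.
move=> s0 x; have cs0 := child_side_gt0 w s0.
have s2 t : 0 < t -> 0 < 2 * t :> R by move=> t0; rewrite mulr_gt0.
move=> /(rV_ballE _ _ (s2 _ cs0)) H; apply/(rV_ballE _ _ (s2 _ s0)) => k.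
have := H k; have := corner_le (R := R) B_gt1 w k.
have /andP[c0 _] := @corner_itv R d B B_gt1 w k.
have : child_side s w <= s by exact: child_side_le (ltW s0).
rewrite child_cornerE /child_side.
move: c0; set c := corner w _ _; set e := _ ^- _ => c0 se c1.
have := mulr_ge0 (ltW s0) c0; have := ler_wpM2l (ltW s0) c1.
rewrite mulrBr mulr1 !ltr_norml => h3 h4 /andP[h1 h2]; apply/andP; split; lra.
Qed.

Section Mass.
Variable mu : {measure set (borelRd R d) -> \bar R}.
Hypothesis mu_compact : forall K : set 'rV[R]_d, compact K -> (mu K < +oo)%E.

Lemma ball_measurable_borelRd p (r : R) : measurable (ball p r : set (borelRd R d)).
Proof.
apply: open_measurable_borelRd; have [r0|r0] := ltP 0 r; first exact: ball_open.
rewrite (_ : ball p r = set0); first exact: open0.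
by apply/seteqP; split=> // x []; rewrite ltNge r0.
Qed.

Lemma bounded_mass_lty (A : set 'rV[R]_d) (C : R) : measurable (A : set (borelRd R d)) ->
  (forall x, A x -> `|x| <= C) -> (mu A < +oo)%E.
Proof.
move=> mA AC; pose K : set 'rV[R]_d := [set x | `|x| <= C].
apply: (@le_lt_trans _ _ (mu K)); last by apply: mu_compact; exact: compact_norm_le.
apply: le_measure; rewrite ?inE //.
by apply: closed_measurable_borelRd; exact: closed_norm_le.
Qed.

Lemma ball_mass_fin p (r : R) : mu (ball p r) \is a fin_num.
Proof.
rewrite ge0_fin_numE //; apply: (@bounded_mass_lty _ (`|p| + r)).
  exact: ball_measurable_borelRd.
move=> x; rewrite -ball_normE /= => px.
by rewrite -[x](subKr p) (le_trans (ler_normB _ _)) // lerD2l ltW.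
Qed.

(** The enlarged cube contains the closed balls of radius at most [s] around the points of the cell.
    Enlarged cubes of descendants stay inside that of the ancestor, and those of one generation
    overlap at most [4 ^+ d] times. *)
Definition cube_mass p s : R := fine (mu (ball p (2 * s))).

Lemma cube_massE p s : (cube_mass p s)%:E = mu (ball p (2 * s)).
Proof. by rewrite fineK // ball_mass_fin. Qed.

Lemma cube_mass_ge0 p s : 0 <= cube_mass p s.
Proof. by rewrite fine_ge0. Qed.

Lemma child_mass_le p s w : 0 < s ->
  cube_mass (child_corner p s w) (child_side s w) <= cube_mass p s.
Proof.
move=> s0; rewrite -lee_fin !cube_massE; apply: le_measure; rewrite ?inE;
  try exact: ball_measurable_borelRd.
exact: child_cube_sub.
Qed.

Lemma sum_child_mass p s n : 0 < s ->
  \sum_(w : n.-tuple D) cube_mass (child_corner p s w) (child_side s w)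
  <= 4 ^+ d * cube_mass p s.
Proof.
move=> s0; rewrite -lee_fin -sumEFin EFinM.
under eq_bigr do rewrite cube_massE.
rewrite cube_massE; apply: sum_measure_le => //.
- exact: ball_measurable_borelRd.
- by move=> w; exact: ball_measurable_borelRd.
- by move=> w; exact: child_cube_sub.
move=> x; apply: le_trans (corner_count B_gt1 (s^-1 *: (x - p)) n).
apply: ler_sum => w _; rewrite indicE; case: (boolP (_ \in _)) => //.
rewrite inE => /rV_ballE H.
rewrite (_ : [forall k, _] = true) //; apply/forallP => k.
have cs0 := child_side_gt0 w s0; have {}H := H (mulr_gt0 (ltr0Sn R 1) cs0) k.
move: H; rewrite child_cornerE /child_side size_tuple.
have -> : (s^-1 *: (x - p)) ord0 k = s^-1 * (x ord0 k - p ord0 k) by rewrite !mxE.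
set c := corner w _ _; set e := _ ^- _ => H.
have sn : s != 0 by rewrite gt_eqF.
have -> : s^-1 * (x ord0 k - p ord0 k) - c = - (s^-1 * (p ord0 k + s * c - x ord0 k)).
  by rewrite !(mulrBr, mulrDr) mulrA mulVf // mul1r; ring.
rewrite normrN normrM gtr0_norm ?invr_gt0 // mulrC ltr_pdivrMr //.
by rewrite -mulrA [e * s]mulrC.
Qed.

End Mass.
End Cubes.

(** * The counting estimate *)

Lemma nneseries_geometric_lty {R : realType} (C q : R) : 0 <= q < 1 ->
  (\sum_(n <oo) (C * q ^+ n)%:E < +oo)%E.
Proof.
move=> /andP[q0 q1].
have q_lt1 : `|q| < 1 by rewrite ger0_norm.
have : eseries (fun k => (C * q ^+ k)%:E) @ \oo --> (C / (1 - q))%:E.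
  apply: cvg_EFin; first by apply: nearW => //= x; rewrite /eseries /= sumEFin.
  rewrite [X in X @ _ --> _](_ : _ = series (geometric C q)).
    exact: cvg_geometric_series.
  by apply/funext => n /=; rewrite /eseries /= sumEFin.
by move=> /cvg_lim -> //; rewrite ltry.
Qed.

Section Pressure.
Context {R : realType} {d B : nat}.
Hypothesis B_gt1 : (1 < B)%N.
Local Notation D := {ffun 'I_d -> 'I_B}.
Implicit Types (p x y : 'rV[R]_d) (s r : R) (w q u : seq D).
Variable mu : {measure set (borelRd R d) -> \bar R}.
Hypothesis mu_compact : forall K : set 'rV[R]_d, compact K -> (mu K < +oo)%E.

Let b_gt0 : 0 < B%:R :> R. Proof. by rewrite ltr0n ltnW. Qed.

(** Porosity made uniform: for a fixed [eps > 0], the points of porosity lie in the countable union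
    of these sets over the thresholds [r0 = 1/(j+1)]. *)
Definition porous_points (alpha eps r0 : R) : set 'rV[R]_d :=
  [set x | forall r, 0 < r < r0 -> exists y : 'rV[R]_d,
    eball y (alpha * r) `<=` ecball x r /\
    (mu (eball y (alpha * r)) <= eps%:E * mu (ecball x r))%E].

(** Sums of square roots of masses measure how many cells the mass is spread over. Cells that miss
    [A] are left out, since no holes are known there. *)
Definition hit_weight (A : set 'rV[R]_d) p s : R :=
  `[< cell p s `&` A !=set0 >]%:R * Num.sqrt (cube_mass mu p s).

Lemma hit_weight_ge0 A p s : 0 <= hit_weight A p s.
Proof. by rewrite mulr_ge0 // sqrtr_ge0. Qed.

Lemma ecball_measurable_borelRd x r : measurable (ecball x r : set (borelRd R d)).
Proof.
apply: closed_measurable_borelRd.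
rewrite /ecball -[X in closed X]/((fun y : 'rV[R]_d => enorm (y - x)) @^-1` [set t | t <= r]).
by apply: closed_comp => [y _|]; [exact: continuous_enorm | exact: closed_le].
Qed.

Variables (alpha alpha' beta delta eps r0 : R) (M : nat).
Hypothesis alpha'_itv : 0 < alpha' <= 1.
Hypothesis alpha'_near : alpha <= alpha' + delta / 2.
Hypothesis delta_gt0 : 0 < delta.
(** Going from the corner of a cell of generation [M] to any point of its enlarged cube costs at
    most [delta / 2], relative to the root cube. *)
Hypothesis M_large : 4 * d%:R * B%:R ^- M <= delta.
Hypothesis eps_ge0 : 0 <= eps.
Hypothesis d_gt0 : (0 < d)%N.

Let A := porous_points alpha' eps r0.

Definition heavy p s u : Prop :=
  cell (child_corner p s u) (child_side s u) `&` A !=set0 /\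
  eps * cube_mass mu p s < cube_mass mu (child_corner p s u) (child_side s u).

(* A hole of a point of [A] at a scale below [s] carries at most the fraction
   [eps] of the mass of the cube of side [s]; it cannot contain a heavy cube. *)
Lemma heavy_config p s (W : seq D -> R) : 0 < s < r0 ->
  W [::] = 1 -> (forall w, 0 <= W w) ->
  (forall w, (size w < M)%N -> W w = \sum_i W (rcons w i)) ->
  (forall w, (size w <= M)%N -> W w <= beta ^+ size w) ->
  (forall w, size w = M -> 0 < W w -> heavy p s w) ->
  @porous_config R d B alpha beta delta M.
Proof.
move=> /andP[s0 sr0] W1 W0 Wr Wb Wh; exists W; split=> // u su Wu r /andP[dr r1].
have [[x [xc xA]] _] := Wh _ su Wu.
have r_gt0 : 0 < r by exact: lt_le_trans dr.
have /andP[a0 a1] := alpha'_itv.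
have sn : s != 0 by rewrite gt_eqF.
have rs0 : 0 < r * s by rewrite mulr_gt0.
have rss : r * s <= s by rewrite ler_piMl // ltW.
(* The scale [r] of the unit cube is the scale [r * s] in the cube of side [s]; the hole found there
   is scaled back. *)
have [|y [yx ym]] := xA (r * s); first by rewrite rs0 (le_lt_trans rss).
have dist_yx : enorm (y - x) <= r * s - alpha' * (r * s).
  by apply: eball_sub_ecball yx; rewrite mulr_gt0 //= ler_piMl // ltW.
pose e : R := B%:R ^- M.
have e0 : 0 < e by rewrite invr_gt0 exprn_gt0.
have d1 : 1 <= d%:R :> R by rewrite ler1n.
have de : 4 * d%:R * e <= delta by exact: M_large.
have scaled v : corner v - s^-1 *: (y - p) = s^-1 *: (child_corner p s v - y).
  apply/rowP => k; rewrite /child_corner; move: (corner v) => c; rewrite !mxE.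
  by field.
have scale_norm v : enorm (s^-1 *: v : 'rV[R]_d) = enorm v / s.
  by rewrite enormZ gtr0_norm ?invr_gt0 // mulrC.
exists (s^-1 *: (y - p)); split.
  rewrite enormB scaled scale_norm ler_pdivrMr // enormB.
  apply: (le_trans (enorm_triangle x _ _)).
  have : enorm (x - child_corner p s u) <= d%:R * (s * e).
    apply: enorm_le_coord; first by rewrite mulr_ge0 ?ltW.
    move=> k; have := xc k; rewrite /child_side su -/e !mxE => /andP[h1 h2].
    by rewrite ger0_norm // ltW.
  (* The tolerance pays [delta / 4] for moving from the corner to the point [x] of [A], and
     [delta / 2] for the gap between [alpha] and [alpha']. *)
  have h3 : d%:R * e <= delta / 4 by lra.
  have h4 : d%:R * (s * e) <= s * (delta / 4) by rewrite mulrCA ler_wpM2l // ltW.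
  have h5 : (1 - alpha') * r <= (1 - alpha) * r + delta / 2.
    have : (alpha - alpha') * r <= delta / 2 * 1.
      apply: (@le_trans _ _ (delta / 2 * r)).
        by rewrite ler_wpM2r ?(ltW r_gt0) //; move: alpha'_near; lra.
      by rewrite ler_wpM2l // divr_ge0 // ltW.
    lra.
  have h6 := ler_wpM2l (ltW s0) h5.
  move: dist_yx; rewrite (mulrC r s).
  have -> : alpha' * (s * r) = s * (alpha' * r) by rewrite mulrCA.
  have := mulr_gt0 s0 delta_gt0.
  rewrite mulrDl [_ * s]mulrC => hs hy hx.
  move: h6 hy hx h4; rewrite !(mulrDr, mulrBl, mul1r, mulrBr) => *; lra.
move=> u' su' Wu'; have [_ heavy_u'] := Wh _ su' Wu'.
(* Otherwise the corner is so deep in the hole that, after [delta / 2] is spent on the gap between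
   [alpha] and [alpha'], the other half covers the whole enlarged cube. *)
rewrite leNgt; apply/negP; rewrite scaled scale_norm ltr_pdivrMr // => lt.
move: heavy_u'; apply/negP; rewrite -leNgt.
rewrite -lee_fin EFinM !cube_massE //.
apply: (@le_trans _ _ (mu (eball y (alpha' * (r * s))))).
  apply: le_measure; rewrite ?inE.
  - exact: ball_measurable_borelRd.
  - by apply: open_measurable_borelRd; exact: eball_open.
  move=> z; have cs0 : 0 < 2 * child_side s u' by rewrite mulr_gt0 // child_side_gt0.
  move=> /(rV_ballE _ _ cs0) H; rewrite /eball /=.
  apply: (le_lt_trans (enorm_triangle (child_corner p s u') _ _)).
  have : enorm (z - child_corner p s u') <= d%:R * (2 * (s * e)).
    apply: enorm_le_coord; first by rewrite !mulr_ge0 // ltW.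
    move=> k; have := H k; rewrite /child_side su' -/e !mxE distrC; exact: ltW.
  have h3 : d%:R * (2 * (s * e)) <= s * (delta / 2).
    have -> : d%:R * (2 * (s * e)) = s * (d%:R * (2 * e)) by ring.
    by rewrite ler_wpM2l ?(ltW s0) //; lra.
  have h4 : alpha * r <= alpha' * r + delta / 2.
    have : (alpha - alpha') * r <= delta / 2 * 1.
      apply: (@le_trans _ _ (delta / 2 * r)).
        by rewrite ler_wpM2r ?(ltW r_gt0) //; move: alpha'_near; lra.
      by rewrite ler_wpM2l // divr_ge0 // ltW.
    lra.
  have h5 := ler_wpM2r (ltW s0) h4.
  move: lt; rewrite (mulrA alpha') !(mulrDl, mulrBl, mulrDr) => *.
  by move: h5; rewrite mulrDl => *; lra.
apply: le_trans ym _; apply: lee_wpmul2l; first by rewrite lee_fin.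
apply: le_measure; rewrite ?inE.
- exact: ecball_measurable_borelRd.
- exact: ball_measurable_borelRd.
move=> z zx; apply/rV_ballE; first by rewrite mulr_gt0.
move=> k; have := child_cell_sub B_gt1 s0 xc k.
have : `|(z - x) ord0 k| <= s.
  by apply: le_trans rss; apply: le_trans zx; exact: coord_le_enorm.
rewrite !mxE ler_norml ltr_norml => /andP[h1 h2] /andP[h3 h4].
by apply/andP; split; lra.
Qed.

Hypothesis no_config : ~ @porous_config R d B alpha beta delta M.
Hypothesis M_gt0 : (0 < M)%N.
(** In the application [rho] is [B^(-b/2)] and [sigma] is [B^(-b'/2)] with [b < b']. A cut word of
    generation [l] gains [sigma ^+ l] from the induction and loses [rho ^- l] to Cauchy-Schwarz:
    [ratio_small] is the cost of the heavy cut, [eps_small] that of the light cells. *)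
Variables (rho sigma : R).
Hypothesis rho_gt0 : 0 < rho.
Hypothesis betaE : beta = rho ^+ 2.
Hypothesis sigma_itv : 0 < sigma <= 1.
Hypothesis ratio_small : 2 ^+ d * \sum_(l < M) (sigma / rho) ^+ l.+1 <= 2^-1.
Let N : R := #|{: D}|%:R ^+ M.
Hypothesis eps_small : N * Num.sqrt eps <= 2^-1.

(** A flow of value 1 would be an excluded configuration, so the maximal flow, and with it the cut,
    is below 1. The root alone costs 1, so it is not in the cut. *)
Lemma heavy_cut p s : 0 < s < r0 -> exists C : pred (seq D),
  [/\ C [::] = false,
     forall l, (l <= M)%N -> \sum_(q : l.-tuple D) (C q)%:R * (rho ^+ l) ^+ 2 <= 1
   & forall w, size w = M -> heavy p s w -> exists2 l, (l <= M)%N & C (take l w)].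
Proof.
move=> s0r; have beta_ge0 l : 0 <= beta ^+ l by rewrite betaE exprn_ge0 // sqr_ge0.
have [W [C [W0 Wr Wb Wh [WC Cov]]]] :=
  @max_flow_min_cut R D M (fun l => beta ^+ l) (fun w => `[< heavy p s w >]) beta_ge0.
have W1 : W [::] < 1.
  rewrite lt_neqAle -(expr0 beta) (Wb [::]) // andbT expr0; apply/eqP => W1.
  apply: no_config; apply: (heavy_config s0r W1) => // w sw Ww.
  by apply/asboolP; exact: Wh.
have sum_le l : (l <= M)%N -> \sum_(q : l.-tuple D) (C q)%:R * beta ^+ l <= W [::].
  move=> lM; rewrite WC (bigD1 (Ordinal (lM : (l < M.+1)%N))) //= lerDl.
  by apply: sumr_ge0 => i _; apply: sumr_ge0 => q _; rewrite mulr_ge0.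
exists C; split.
- apply/negbTE/negP => C0; have := sum_le 0%N (leq0n _).
  have /= -> := sum_words0 (fun q => (C q)%:R * beta ^+ 0).
  by rewrite C0 expr0 mulr1 leNgt W1.
- move=> l lM; apply: le_trans (ltW W1); apply: le_trans (sum_le l lM).
  by rewrite le_eqVlt; apply/orP; left; apply/eqP; apply: eq_bigr => q _;
    rewrite betaE -!exprM mulnC.
- by move=> w sw hw; apply: Cov => //; exact/asboolP.
Qed.

Lemma hit_weight_le p s : hit_weight A p s <= Num.sqrt (cube_mass mu p s).
Proof. by rewrite /hit_weight; case: asbool; rewrite ?mul1r ?mul0r // sqrtr_ge0. Qed.

(** Strong induction on [n]: the first [M] generations are cut at the heavy cut and at the light
    cells of generation [M], and the induction hypothesis is applied below each cut word. *)
Lemma pressure_bound n p s : 0 < s < r0 ->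
  \sum_(w : n.-tuple D) hit_weight A (child_corner p s w) (child_side s w)
  <= N / sigma ^+ n * Num.sqrt (cube_mass mu p s).
Proof.
have /andP[sg0 sg1] := sigma_itv.
have N0 : 0 <= N by rewrite exprn_ge0.
have D1 : (1 <= #|{: D}|)%N.
  by rewrite card_ffun !card_ord expn_gt0 ltnW.
have mass_le p' s' w : 0 < s' -> Num.sqrt (cube_mass mu (child_corner p' s' w) (child_side s' w))
    <= Num.sqrt (cube_mass mu p' s').
  by move=> s'0; rewrite ler_sqrt ?cube_mass_ge0 // child_mass_le.
elim/ltn_ind: n p s => n IH p s s0r; have /andP[s0 sr0] := s0r.
(* With fewer than [M] generations it suffices to count the words: there are at most [N], and
   [sigma <= 1]. *)
have [nM|Mn] := ltnP n M.
  apply: (@le_trans _ _ (\sum_(w : n.-tuple D) Num.sqrt (cube_mass mu p s))).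
    by apply: ler_sum => w _; apply: le_trans (hit_weight_le _ _) _; exact: mass_le.
  rewrite sumr_const card_tuple -[leLHS]mulr_natl ler_wpM2r ?sqrtr_ge0 //.
  rewrite natrX ler_pdivlMr ?exprn_gt0 //.
  apply: (@le_trans _ _ (#|{: D}|%:R ^+ n)).
    by rewrite ler_piMr ?exprn_ge0 // exprn_ile1 // ltW.
  by rewrite ler_weXn2l ?ler1n // ltnW.
have [C [C0 Csum Ccov]] := heavy_cut p s0r.
pose m w := cube_mass mu (child_corner p s w) (child_side s w).
have m0 w : 0 <= m w by exact: cube_mass_ge0.
pose bad w := m w <= eps * cube_mass mu p s.
(* The heavy cut stops heavy cells only; the light ones are stopped at generation [M]. *)
pose CC l q := C q || ((l == M) && bad q).
pose phi w := hit_weight A (child_corner p s w) (child_side s w).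
have cover w : size w = n -> 0 < phi w -> exists2 l, (l <= M)%N & CC l (take l w).
  move=> sw; rewrite /phi /hit_weight.
  case: (asboolP (_ !=set0)); last by rewrite mul0r ltxx.
  move=> [x [xc xA]] _.
  have [bw|nbw] := boolP (bad (take M w)).
    by exists M => //; rewrite /CC eqxx bw orbT.
  have szM : size (take M w) = M by rewrite size_takel // sw.
  have [|l lM Cl] := Ccov _ szM.
    split; last by rewrite ltNge.
    exists x; split=> //; have cs0 := child_side_gt0 B_gt1 (take M w) s0.
    apply: (@child_cell_sub _ _ _ B_gt1 _ _ (drop M w) cs0).
    by rewrite -child_corner_cat // -child_side_cat cat_take_drop; exact: xc.
  by exists l => //; rewrite /CC; move: Cl; rewrite take_takel // => ->.
have := sum_words_le_cut Mn (fun w => hit_weight_ge0 A _ _) cover.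
move=> /le_trans; apply.
set K := N / sigma ^+ n; have K0 : 0 <= K by rewrite divr_ge0 // exprn_ge0 // ltW.
(* The root is in no cut, so the induction hypothesis is applied to strictly fewer generations. *)
rewrite big_ord_recl [X in X + _ <= _](_ : _ = 0) ?add0r; last first.
  apply: big1 => q _; rewrite (_ : CC _ _ = false) ?mul0r //.
  rewrite /CC [tval q](_ : _ = [::]) ?C0 /=; last by apply: size0nil; rewrite size_tuple.
  by rewrite eq_sym (gtn_eqF M_gt0).
have term l (q : l.+1.-tuple D) : (l < M)%N ->
  (CC l.+1 q)%:R * \sum_(w : (n - l.+1).-tuple D) phi (q ++ w) <=
  K * (sigma ^+ l.+1 * ((C q)%:R * Num.sqrt (m q)) +
       (l.+1 == M)%:R * Num.sqrt (eps * cube_mass mu p s)).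
  move=> lM; have ln : (l.+1 <= n)%N by exact: leq_trans lM Mn.
  have cs0 : 0 < child_side s q < r0.
    by rewrite child_side_gt0 //=; apply: le_lt_trans sr0; apply: child_side_le => //; exact: ltW.
  have := IH (n - l.+1)%N _ (child_corner p s q) (child_side s q) cs0.
  rewrite ltn_subrL (leq_trans _ ln) // => /(_ isT).
  have -> : N / sigma ^+ (n - l.+1) = K * sigma ^+ l.+1.
    rewrite /K -{2}(subnK ln) exprD invfM -!mulrA mulVf ?mulr1 //.
    by rewrite expf_neq0 // gt_eqF.
  under eq_bigr do rewrite -child_corner_cat // -child_side_cat.
  rewrite -/(m q) => IHq.
  have Kmq : 0 <= K * sigma ^+ l.+1 * Num.sqrt (m q).
    by rewrite mulr_ge0 ?sqrtr_ge0 // mulr_ge0 // exprn_ge0 // ltW.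
  have rest0 : 0 <= (l.+1 == M)%:R * Num.sqrt (eps * cube_mass mu p s) :> R.
    by rewrite mulr_ge0 ?sqrtr_ge0.
  rewrite -[CC _ _]/(C q || ((l.+1 == M) && bad q)); case: (C q).
    rewrite /= !mul1r; apply: le_trans IHq _; rewrite -mulrA ler_wpM2l // lerDl.
    exact: rest0.
  rewrite !mul0r mulr0 add0r.
  case: (l.+1 == M) rest0 => /=; last by rewrite !mul0r mulr0.
  case bq : (bad q); last by rewrite !mul0r => ?; rewrite mulr_ge0.
  rewrite !mul1r => _; apply: le_trans IHq _; rewrite -mulrA ler_wpM2l //.
  apply: (@le_trans _ _ (Num.sqrt (m q))).
    by rewrite ler_piMl ?sqrtr_ge0 // exprn_ile1 // ltW.
  by rewrite ler_sqrt ?mulr_ge0 ?cube_mass_ge0.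
apply: (@le_trans _ _ (\sum_(l < M) K * (
   sigma ^+ l.+1 * (2 ^+ d * Num.sqrt (cube_mass mu p s) / rho ^+ l.+1) +
   (l.+1 == M)%:R * (N * Num.sqrt (eps * cube_mass mu p s))))).
  apply: ler_sum => l _; have lM := ltn_ord l.
  apply: (@le_trans _ _ (\sum_(q : l.+1.-tuple D) K *
      (sigma ^+ l.+1 * ((C q)%:R * Num.sqrt (m q)) +
       (l.+1 == M)%:R * Num.sqrt (eps * cube_mass mu p s)))).
    by apply: ler_sum => q _; exact: term.
  rewrite -mulr_sumr ler_wpM2l // big_split /= -!mulr_sumr; apply: lerD.
    rewrite ler_wpM2l ?exprn_ge0 ?(ltW sg0) //.
    (* Here [t = rho ^+ l.+1], and [G] is [2 ^+ d] times the root of the mass, since the masses of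
       one generation add up to at most [4 ^+ d] times that mass. *)
    apply: sum_sqrt_le; rewrite ?exprn_gt0 ?mulr_ge0 ?exprn_ge0 ?sqrtr_ge0 //.
    - rewrite exprMn sqr_sqrtr ?cube_mass_ge0 // -exprM mulnC exprM -[2 ^+ 2]natrX.
      exact: sum_child_mass.
    - exact: Csum.
  rewrite sumr_const card_tuple -[X in _ * X <= _]mulr_natl natrX.
  have [->|] := eqVneq l.+1 M; first by rewrite mul1r.
  by rewrite !mul0r.
rewrite -mulr_sumr; apply: ler_wpM2l => //; rewrite big_split /=.
(* One half pays for the heavy cut, the other for the light cells. *)
rewrite [leRHS](_ : _ = 2^-1 * Num.sqrt (cube_mass mu p s) +
   2^-1 * Num.sqrt (cube_mass mu p s)); last by field.
apply: lerD.
  apply: le_trans (ler_wpM2r (sqrtr_ge0 _) ratio_small).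
  rewrite mulr_sumr mulr_suml le_eqVlt; apply/orP; left; apply/eqP.
  apply: eq_bigr => l _; rewrite expr_div_n.
  by field; rewrite expf_neq0 // gt_eqF.
rewrite -mulr_suml; case: (M) M_gt0 => // M' _.
rewrite big_ord_recr /= eqxx big1 ?add0r ?mul1r; last first.
  by move=> l _; rewrite eqSS (ltn_eqF (ltn_ord l)).
by rewrite sqrtrM // mulrA ler_wpM2r ?sqrtr_ge0.
Qed.

Variable a : R.
Hypothesis a_gt0 : 0 < a.
Hypothesis sigma_large : B%:R `^ (- a) < sigma ^+ 2.

(** Borel-Cantelli: an exceptional point lies in cells of arbitrarily large generation [n] that have
    mass at most [C1 * B^(-a n)] and meet [A]. The total mass of these cells is at most a constant
    times [q ^+ n] with [q < 1]. *)
Lemma exceptional_negligible p s : 0 < s < r0 ->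
  mu.-negligible [set x | [/\ A x, cell p s x & (a%:E < upper_local_dim mu x)%E]].
Proof.
move=> s0r; have /andP[s0 sr0] := s0r; have /andP[sg0 sg1] := sigma_itv.
pose tau2 : R := B%:R `^ (- a).
have tau2_gt0 : 0 < tau2 by rewrite powR_gt0.
have sqrt_tau k : Num.sqrt (tau2 ^+ k) = Num.sqrt tau2 ^+ k.
  by elim: k => [|k IH]; rewrite ?expr0 ?sqrtr1 // !exprS sqrtrM ?IH // ltW.
(* Points of a cell and of its enlarged cube are less than [c0] sides apart; [d.+1] instead of [d]
   makes this strict. The factor [B] in [C1] is the loss from rounding a radius to a power of
   [B]. *)
pose c0 : R := 3 * d.+1%:R; have c0_gt0 : 0 < c0 by rewrite mulr_gt0.
pose C1 : R := (c0 * s * B%:R) `^ a; have C1_ge0 : 0 <= C1 by rewrite powR_ge0.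
pose m w := cube_mass mu (child_corner p s w) (child_side s w).
have m0 w : 0 <= m w by exact: cube_mass_ge0.
pose good n (w : n.-tuple D) :=
  `[< cell (child_corner p s w) (child_side s w) `&` A !=set0 >] &&
  (m w <= C1 * tau2 ^+ n).
pose F n (w : n.-tuple D) : set (borelRd R d) :=
  ball (child_corner p s w) (2 * child_side s w).
pose Y n : set (borelRd R d) := \big[setU/set0]_(w : n.-tuple D | good n w) F n w.
have mF n (w : n.-tuple D) : measurable (F n w) by exact: ball_measurable_borelRd.
have mY n : measurable (Y n) by apply: bigsetU_measurable => w _; exact: mF.
pose q := Num.sqrt tau2 / sigma.
have q01 : 0 <= q < 1.
  rewrite divr_ge0 ?sqrtr_ge0 ?(ltW sg0) //= ltr_pdivrMr // mul1r.
  by rewrite -(gtr0_norm sg0) -sqrtr_sqr ltr_sqrt // exprn_gt0.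
pose K1 := Num.sqrt C1 * N * Num.sqrt (cube_mass mu p s).
have Yle n : (mu (Y n) <= (K1 * q ^+ n)%:E)%E.
  apply: (le_trans (measure_bigsetU_le _ _ _ (mF n))).
  have -> : (\sum_(w : n.-tuple D | good n w) mu (F n w) =
             (\sum_(w : n.-tuple D | good n w) m w)%:E)%E.
    by rewrite -sumEFin; apply: eq_bigr => w _; rewrite cube_massE.
  (* A mass of at most [C1 * tau2 ^+ n] is at most the root of this bound times its own root. *)
  rewrite lee_fin; apply: (@le_trans _ _ (\sum_(w : n.-tuple D)
     Num.sqrt C1 * Num.sqrt tau2 ^+ n *
     hit_weight A (child_corner p s w) (child_side s w))).
    rewrite big_mkcond; apply: ler_sum => w _; case: ifP => [/andP[hw mw]|_]; last first.
      by rewrite !mulr_ge0 ?exprn_ge0 ?sqrtr_ge0 ?hit_weight_ge0.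
    rewrite /hit_weight hw mul1r -/(m w) -{1}(sqr_sqrtr (m0 w)) expr2.
    rewrite ler_wpM2r ?sqrtr_ge0 //.
    have -> : Num.sqrt C1 * Num.sqrt tau2 ^+ n = Num.sqrt (C1 * tau2 ^+ n).
      by rewrite sqrtrM // sqrt_tau.
    by rewrite ler_sqrt // mulr_ge0 ?exprn_ge0 // ltW.
  rewrite -mulr_sumr; apply: le_trans (ler_wpM2l _ (pressure_bound n p s0r)) _.
    by rewrite mulr_ge0 ?exprn_ge0 ?sqrtr_ge0.
  rewrite le_eqVlt; apply/orP; left; apply/eqP; rewrite /K1 /q expr_div_n.
  by field; rewrite expf_neq0 // gt_eqF.
exists (lim_sup_set Y); split.
- by apply: bigcap_measurable => // k _; apply: bigcup_measurable => j _; exact: mY.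
- apply: lim_sup_set_cvg0 => //; apply: le_lt_trans (nneseries_geometric_lty K1 q01).
  by apply: lee_nneseries.
move=> x [Ax px ax] n0 _.
pose e : R := c0 * s * B%:R ^- n0.
have e0 : 0 < e by rewrite !mulr_gt0 // invr_gt0 exprn_gt0.
have [r [r_gt0 r_lt1 re dim_r]] : exists r : R,
    [/\ 0 < r, r < 1, r < e & (a%:E < lne (mu (eball x r)) / (ln r)%:E)%E].
  have me0 : 0 < Num.min 1 e by rewrite lt_min ltr01.
  pose V : set R := [set r | 0 < r] `&` [set r | r < Num.min 1 e].
  have V0 : (0%R^'+)%classic V.
    by apply: filterI; [exact: nbhs_right_gt | exact: nbhs_right_lt].
  have : (a%:E < ereal_sup ((fun r => lne (mu (eball x r)) / (ln r)%:E) @` V))%E.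
    apply: lt_le_trans ax _; apply: ereal_inf_lbound; by exists V.
  move=> /ereal_sup_gt[_ [r [r_gt0 rlt] <-] ar].
  move: rlt; rewrite /= lt_min => /andP[r1 re].
  by exists r.
have ball_le : (mu (eball x r) <= (r `^ a)%:E)%E.
  by apply: lt_lne_ratio dim_r; rewrite ?r_gt0 //; exact: measure_ge0.
have ex_n : exists n, c0 * s * B%:R ^- n <= r.
  have [n Bn] := expVn_lt B_gt1 (divr_gt0 r_gt0 (mulr_gt0 c0_gt0 s0)).
  by exists n; rewrite mulrC -ler_pdivlMr ?mulr_gt0 // ltW.
(* The first generation whose enlarged cubes fit into the ball: [r < e] forces it beyond [n0], and
   minimality bounds [r] from above. *)
case: (ex_minnP ex_n) => n nr nmin.
have n0n : (n0 < n)%N.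
  rewrite ltnNge; apply/negP => nn0; move: (le_lt_trans nr re); rewrite /e.
  rewrite ltr_pM2l ?mulr_gt0 // ltf_pV2 ?posrE ?exprn_gt0 // ltr_eXn2l ?ltr1n //.
  by rewrite ltnNge nn0.
have rn : r <= c0 * s * B%:R * B%:R ^- n.
  rewrite leNgt; apply/negP => lt; move: n0n nmin lt; case: n {nr} => // n _ nmin.
  rewrite exprS invfM mulrA mulfK ?gt_eqF // => /ltW/nmin.
  by rewrite ltnn.
have [w wx] := cell_cover B_gt1 n s0 px.
exists n; first exact: ltnW.
have ball_sub : F n w `<=` eball x r.
  move=> z; have cs0 : 0 < 2 * child_side s w by rewrite mulr_gt0 // child_side_gt0.
  move=> /(rV_ballE _ _ cs0) H; rewrite /eball /=.
  have se0 : 0 < s * B%:R ^- n by rewrite mulr_gt0 // invr_gt0 exprn_gt0.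
  apply: (@le_lt_trans _ _ (d%:R * (3 * (s * B%:R ^- n)))).
    apply: enorm_le_coord; first by rewrite mulr_ge0 // ltW.
    move=> k; have -> : (z - x) ord0 k = z ord0 k - x ord0 k by rewrite !mxE.
    have := H k; have := wx k; rewrite /child_side size_tuple.
    set u := child_corner p s w ord0 k; move=> /andP[h1 h2]; rewrite ltr_norml => /andP[h3 h4].
    by rewrite ler_norml; apply/andP; split; lra.
  apply: lt_le_trans nr; rewrite /c0.
  have -> : 3 * d.+1%:R * s * B%:R ^- n = d.+1%:R * (3 * (s * B%:R ^- n)) by ring.
  by rewrite ltr_pM2r ?ltr_nat // mulr_gt0.
have gw : good n w.
  apply/andP; split; first by apply/asboolP; exists x.
  rewrite -lee_fin cube_massE //; apply: (@le_trans _ _ (mu (eball x r))).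
    apply: le_measure; rewrite ?inE //; first exact: mF.
    by apply: open_measurable_borelRd; exact: eball_open.
  apply: le_trans ball_le _; rewrite lee_fin.
  have x_ge0 : 0 <= c0 * s * B%:R by rewrite !mulr_ge0 // ltW.
  have y_ge0 : 0 <= B%:R ^- n :> R by rewrite invr_ge0 exprn_ge0 // ltW.
  rewrite /C1 /tau2 -powR_cell -powRM //.
  by apply: ge0_ler_powR rn; rewrite ?nnegrE ?mulr_ge0 // ltW.
rewrite /Y (bigD1 w) //=; left.
apply/(rV_ballE _ _ _); first by rewrite mulr_gt0 // child_side_gt0.
move=> k; have /andP[h1 h2] := wx k.
by rewrite distrC ger0_norm //; apply: lt_trans h2 _; rewrite ltr_pMl ?child_side_gt0 // ltr1n.
Qed.

End Pressure.

(** * Upper semicontinuity *)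

(** Almost every point is a point of porosity, so it lies in one of countably many pieces on each of
    which the exceptional points are negligible. *)
Lemma Delta_le_of_no_config {R : realType} {d B : nat} (B_gt1 : (1 < B)%N)
    (d_gt0 : (0 < d)%N) (alpha alpha' delta rho sigma a : R) (M : nat) :
  0 < alpha' <= 1 -> alpha <= alpha' + delta / 2 -> 0 < delta ->
  4 * d%:R * B%:R ^- M <= delta -> (0 < M)%N ->
  0 < rho -> 0 < sigma <= 1 ->
  2 ^+ d * \sum_(l < M) (sigma / rho) ^+ l.+1 <= 2^-1 ->
  0 < a -> B%:R `^ (- a) < sigma ^+ 2 ->
  ~ @porous_config R d B alpha (rho ^+ 2) delta M ->
  (Delta d alpha' <= a%:E)%E.
Proof.
move=> al01 al_near delta0 M_large M0 rho0 sg01 ratio a0 sga nconf.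
apply: ge_ereal_sup => _ [mu [[mu_cpt _ _] mu_por] <-].
apply: ereal_inf_lbound => /=.
pose N : R := #|{: {ffun 'I_d -> 'I_B}}|%:R ^+ M.
have N0 : 0 < N.
  by rewrite exprn_gt0 // ltr0n card_ffun !card_ord expn_gt0 ltnW.
pose eps : R := (2 * N) ^- 2.
have eps0 : 0 < eps by rewrite invr_gt0 exprn_gt0 // mulr_gt0.
have eps_small : N * Num.sqrt eps <= 2^-1.
  rewrite /eps -exprVn sqrtr_sqr gtr0_norm ?invr_gt0 ?mulr_gt0 //.
  by rewrite invfM mulrCA divff ?mulr1 // gt_eqF.
(* A grid cube of side [1/(j+2)], strictly below the threshold [1/(j+1)], serves as root cube. *)
pose X j (z : 'rV[int]_d) : set (borelRd R d) :=
  [set x | [/\ porous_points mu alpha' eps j.+1%:R^-1 x,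
    cell (j.+2%:R^-1 *: map_mx intr z) j.+2%:R^-1 x &
    (a%:E < upper_local_dim mu x)%E]].
pose F n : set (borelRd R d) :=
  if unpickle n is Some (j, z) then X j z else set0.
have F_negl n : mu.-negligible (F n).
  rewrite /F; case: (unpickle n) => [[j z]|]; last exact: negligible_set0.
  apply: (exceptional_negligible B_gt1 mu_cpt al01 al_near delta0 M_large
    (ltW eps0) d_gt0 nconf M0 rho0 (erefl _) sg01 ratio eps_small a0 sga).
  by rewrite invr_gt0 ltr0n /= ltf_pV2 ?posrE // ltr_nat.
apply: negligibleS (negligibleU mu_por (negligible_bigcup F_negl)).
move=> x /= /negP; rewrite -ltNge => xa.
have [px|npx] := pselect (porous_at alpha' mu x); [right | by left].
have [e [pe [e0 ee]]] := filter_ex (filterI px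
  (filterI (nbhs_right_gt (0 : R)) (nbhs_right_le eps0))).
have [eta /= eta0 etaP] := pe.
have [j _ jP] := near_infty_natSinv_lt (PosNum eta0).
pose s : R := j.+2%:R^-1.
have s0 : 0 < s by rewrite invr_gt0.
pose z : 'rV[int]_d := \row_k Num.floor (x ord0 k / s).
exists (pickle (j, z)) => //; rewrite /F pickleK; split=> //.
- move=> r /andP[r0 rj].
  have [|y [ys ym]] := etaP r _ r0.
    rewrite /ball /= sub0r normrN gtr0_norm //.
    by apply: lt_trans rj _; exact: jP (leqnn j).
  exists y; split=> //; apply: le_trans ym _.
  by apply: lee_wpmul2r => //; rewrite lee_fin.
- move=> k; rewrite !mxE -/s.
  have /andP[h1 h2] := floor_itv (x ord0 k / s).
  have sn : s != 0 by rewrite gt_eqF.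
  rewrite mulrC -[X in X - _](divfK sn) -mulrBl.
  rewrite mulr_ge0 ?subr_ge0 ?(ltW s0) //= gtr_pMl // ltrBlDl.
  by move: h2; rewrite intrD.
Qed.

(** The Dirac mass at the origin is an example: as [alpha <= 1/2], the ball of radius [alpha * r]
    around a point at distance [r / 2] misses the origin. *)
Lemma Delta_ge0 {R : realType} {d : nat} (d_gt0 : (0 < d)%N) (alpha : R) :
  0 < alpha <= 2^-1 -> (0 <= Delta d alpha)%E.
Proof.
move=> /andP[a0 a1]; pose o : borelRd R d := (0 : 'rV[R]_d).
pose mu : {measure set (borelRd R d) -> \bar R} := dirac o.
have muE A : mu A = (o \in A)%:R%:E by exact: diracE.
have mu_le1 A : (mu A <= 1%:E)%E by rewrite muE lee_fin lern1 leq_b1.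
apply: le_ereal_sup_tmp; exists (upper_packing_dim mu).
  exists mu => //; split.
    by apply: finite_measure_radon; apply: (le_lt_trans (mu_le1 _)); rewrite ltry.
  exists (~` [set o]); split.
  - apply: open_measurable_borelRd; apply: closed_openC.
    by apply: accessible_closed_set1; apply: hausdorff_accessible; exact: norm_hausdorff.
  - by rewrite muE memNset //; apply.
  apply: subsetC => _ ->; near=> e; near=> r.
  have r0 : 0 < r by near: r; exact: nbhs_right_gt.
  pose y : 'rV[R]_d := (r / 2) *: delta_mx ord0 (Ordinal d_gt0).
  have yn : enorm y = r / 2.
    rewrite enormZ gtr0_norm ?divr_gt0 // /enorm (bigD1 (Ordinal d_gt0)) //=.
    rewrite !mxE !eqxx expr1n big1 ?addr0 ?sqrtr1 ?mulr1 // => k kn.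
    by rewrite !mxE (negbTE kn) andbF expr0n.
  exists y; split.
    apply: eball_subset; rewrite subr0 yn.
    have : alpha * r <= 2^-1 * r by rewrite ler_wpM2r // ltW.
    lra.
  rewrite [X in (X <= _)%E]muE memNset.
    by rewrite mule_ge0 // lee_fin ltW.
  rewrite /eball /= sub0r enormN yn => /lt_le_trans.
  have : alpha * r <= 2^-1 * r by rewrite ler_wpM2r // ltW.
  by move=> h /(_ _ h); rewrite mulrC ltxx.
apply: le_upper_packing_dim => [|x]; first by rewrite muE in_setT oner_neq0.
apply: le_ereal_inf_tmp => _ [V V0 <-].
have [r [Vr [r0 r1]]] := filter_ex (filterI V0
  (filterI (nbhs_right_gt (0 : R)) (nbhs_right_lt ltr01))).
apply: le_ereal_sup_tmp; exists (lne (mu (eball x r)) / (ln r)%:E)%E; first by exists r.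
apply: le_lne_ratio; [by rewrite r0 r1 | exact: measure_ge0 |].
by rewrite powRr0.
Unshelve. all: by end_near. Qed.

(** The geometric sum is at most [q / (1 - q)], and [q * (1 + c) <= 1] says that this is at most
    [1 / c]. *)
Lemma sum_powers_le {R : realFieldType} (q c : R) M : 0 <= q -> 0 < c ->
  q * (1 + c) <= 1 -> \sum_(l < M) q ^+ l.+1 <= c^-1.
Proof.
move=> q0 c0 qc; have q1 : q < 1.
  by rewrite -[ltRHS]mul1r; apply: le_lt_trans (_ : q < _) => //; nra.
suff H : (\sum_(l < M) q ^+ l.+1) * (1 - q) <= q.
  rewrite -[_^-1]mul1r ler_pdivlMr //; nra.
have -> : (\sum_(l < M) q ^+ l.+1) * (1 - q) = q - q ^+ M.+1.
  elim: M => [|M IH]; first by rewrite big_ord0 mul0r expr1 subrr.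
  by rewrite big_ord_recr mulrDl IH /= [q ^+ M.+2]exprS; ring.
by rewrite gerBl exprn_ge0.
Qed.

Theorem theorem2p17 (R : realType) (d : nat) (d_gt0 : (0 < d)%N) :
  upper_semicontinuous_on [set alpha : R | 0 < alpha <= 2^-1] (Delta d).
Proof.
move=> alpha /= alpha_itv a Da; have /andP[alpha0 alpha1] := alpha_itv.
have D0 := Delta_ge0 d_gt0 alpha_itv.
have [D DE] : exists D : R, Delta d alpha = D%:E.
  by case: (Delta d alpha) D0 Da => // D _ _; exists D.
rewrite DE lee_fin in D0; rewrite DE lte_fin in Da.
pose t := (a - D) / 4; have t0 : 0 < t by rewrite divr_gt0 // subr_gt0.
(* [D < b0 < b < b' < a0 < a]: configurations with exponent [b] would give dimension at least [b0],
   the counting estimate has exponent [b'], and [a0] is the bound reached, still below [a]. *)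
pose b0 := D + t; pose b := D + t + t / 2; pose b' := D + t + t; pose a0 := D + t + t + t.
have aE : a = D + 4 * t by rewrite /t; field.
(* Chosen so that [2 ^+ d / c] is one half. *)
pose c : R := 2 ^+ d.+1.
have c0 : 0 < c by rewrite exprn_gt0.
(* Large enough for [B^(t/4) >= 1 + c], where [B^(-t/4)] is [sigma / rho]; [.+2] ensures [B > 1]. *)
pose B := (Num.bound ((1 + c) `^ (t / 4)^-1)).+2.
have B_gt1 : (1 < B)%N by [].
have Br1 : 1 < B%:R :> R by rewrite ltr1n.
have Br0 : 0 < B%:R :> R by rewrite ltr0n.
pose rho : R := B%:R `^ (- (b / 2)); pose sigma : R := B%:R `^ (- (b' / 2)).
have rho0 : 0 < rho by rewrite powR_gt0.
have sigma0 : 0 < sigma by rewrite powR_gt0.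
have powR_lt u v : u < v -> B%:R `^ (- v) < B%:R `^ (- u) :> R.
  by move=> uv; rewrite -ltr_ln ?posrE ?powR_gt0 // !ln_powR ltr_pM2r ?ln_gt0 // ltrN2.
have powR_le1 u : 0 < u -> B%:R `^ (- u) <= 1 :> R.
  by move=> /powR_lt/ltW; rewrite oppr0 powRr0.
have sqr_powR u : (B%:R `^ (- (u / 2))) ^+ 2 = B%:R `^ (- u) :> R.
  rewrite -powR_mulrn ?powR_ge0 // -powRrM; congr (_ `^ _).
  by rewrite mulNr divfK.
have ratioE : sigma / rho = B%:R `^ (- (t / 4)).
  rewrite /rho powRN invrK -powRD; last by apply/implyP => _; rewrite gt_eqF.
  by congr (_ `^ _); rewrite /b' /b; field.
have ratio_le : sigma / rho * (1 + c) <= 1.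
  rewrite ratioE powRN mulrC ler_pdivrMr ?powR_gt0 // mul1r.
  have t4 : 0 < t / 4 by rewrite divr_gt0.
  have le1 : (1 + c) `^ (t / 4)^-1 <= B%:R.
    apply: ltW; apply: lt_le_trans (archi_boundP (powR_ge0 _ _)) _.
    by rewrite ler_nat /B leqW.
  apply: le_trans (ge0_ler_powR (ltW t4) _ _ le1); rewrite ?nnegrE ?powR_ge0 ?ler0n //.
  by rewrite -powRrM mulVf ?gt_eqF // powRr1 // addr_ge0 // ltW.
have ratio M : 2 ^+ d * \sum_(l < M) (sigma / rho) ^+ l.+1 <= 2^-1.
  have := sum_powers_le M (divr_ge0 (ltW sigma0) (ltW rho0)) c0 ratio_le.
  have p0 : 0 < 2 ^+ d :> R by rewrite exprn_gt0.
  move=> /(ler_wpM2l (ltW p0))/le_trans; apply; rewrite /c exprSr invfM.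
  by rewrite mulrA divff ?mul1r // gt_eqF.
(* Configurations for every [delta] would force the value at [alpha] to be at least [b0 > D]. *)
have [delta [delta0 nconf]] : exists delta : R, 0 < delta /\
    forall M, B%:R ^- M <= delta -> ~ @porous_config R d B alpha (rho ^+ 2) delta M.
  apply: contrapT => H; have : (b0%:E <= Delta d alpha)%E.
    apply: (@le_Delta_of_configs _ _ _ B_gt1 alpha (rho ^+ 2)).
    - by rewrite alpha0 (le_trans alpha1) // invf_le1 // ler1n.
    - rewrite sqr_ge0 sqr_powR powR_le1 // /b; lra.
    - by rewrite sqr_powR powR_lt // /b0 /b; lra.
    - move=> delta delta0; apply: contrapT => nM; apply: H; exists delta.
      by split=> // M BM conf; apply: nM; exists M.
  by rewrite DE lee_fin /b0 leNgt ltrDl t0.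
have [M0 M0P] : exists n, B%:R ^- n < delta / (4 * d%:R).
  by apply: expVn_lt => //; rewrite divr_gt0 // mulr_gt0 // ltr0n.
pose M := M0.+1.
have M_large : 4 * d%:R * B%:R ^- M <= delta.
  rewrite mulrC -ler_pdivlMr ?mulr_gt0 ?ltr0n //; apply: le_trans (ltW M0P).
  by rewrite lef_pV2 ?posrE ?exprn_gt0 // ler_weXn2l ?(ltW Br1).
have BM : B%:R ^- M <= delta.
  apply: le_trans M_large; rewrite ler_peMl ?invr_ge0 ?exprn_ge0 //.
  by rewrite -natrM ler1n muln_gt0.
(* This radius gives [alpha <= alpha' + delta / 2], the loss that the tolerance of the
   configurations allows. *)
apply/nbhs_ballP; exists (delta / 2) => /=; first by rewrite divr_gt0.
move=> alpha' /= near_alpha /andP[al0 al1].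
apply: (@le_lt_trans _ _ a0%:E); last by rewrite lte_fin /a0 aE; lra.
apply: (Delta_le_of_no_config B_gt1 d_gt0 _ _ delta0 M_large _ rho0 _ (ratio M)
  _ _ (nconf M BM)) => //.
- by rewrite al0 (le_trans al1) // invf_le1 // ler1n.
- move: near_alpha; rewrite /ball /= ltr_norml => /andP[_ h]; lra.
- by rewrite sigma0 powR_le1 // divr_gt0 // /b'; lra.
- by rewrite /a0; lra.
- by rewrite sqr_powR powR_lt // /a0 /b'; lra.
Qed.
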